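(* Let $a, b \in \mathbb{C}\setminus\{0\}$, $c>0$, $c>|a|+|b|+1$ and $0\le\beta<1$. Assume that $$\frac{\Gamma(c)\,\Gamma(c-|a|-|b|)}{\Gamma(c-|a|)\,\Gamma(c-|b|)}\left[\frac{2\,|a|\,(|b|)_2}{(c-|a|)(c-|a|-|b|-1)}\;{}_2F_1(|a|+1,|b|+2;c-|a|+1;-1)+{}_2F_1(|a|,|b|;c-|a|;-1)\right]\le\frac1{2(1-\beta)}+1.$$ Then $\mathcal{I}^{a,\frac b2,\frac{b+1}2}_{\frac c2,\frac{c+1}2}$ maps $\mathcal{R}(\beta)$ into $\mathcal{UCV}$.
   Context: $\mathbb{D}=\{z\in\mathbb{C}:|z|<1\}$. $\mathcal{A}$ is the family of analytic functions $f$ on $\mathbb{D}$ of the form $f(z)=z+\sum_{n\ge2}a_nz^n$. $\mathcal{UCV}$ is the class of uniformly convex functions: $f\in\mathcal{A}$ is in $\mathcal{UCV}$ if and only if $\operatorname{Re}\left(1+\frac{(z-\zeta)f''(z)}{f'(z)}\right)>0$ for all $z,\zeta\in\mathbb{D}$. For $\beta<1$, $\mathcal{R}(\beta)$ is the set of $f\in\mathcal{A}$ for which there exists $\phi\in\mathbb{R}$ with $\operatorname{Re}\left(e^{i\phi}(f'(z)-\beta)\right)>0$ for all $z\in\mathbb{D}$. Pochhammer symbol: $(x)_0=1$, $(x)_n=x(x+1)\cdots(x+n-1)$ for $n\ge1$. Clausen's hypergeometric function is ${}_3F_2(a,b,c;d,e;z)=\sum_{n=0}^\infty\frac{(a)_n(b)_n(c)_n}{(d)_n(e)_n(1)_n}z^n$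 for $|z|<1$, with $d,e\ne0,-1,-2,\dots$. The integral operator is defined for $f(z)=z+\sum_{n\ge2}a_nz^n\in\mathcal{A}$ by the convolution (coefficientwise product) $$\mathcal{I}^{a,\frac b2,\frac{b+1}2}_{\frac c2,\frac{c+1}2}(f)(z)=z\,{}_3F_2\left(a,\tfrac b2,\tfrac{b+1}2;\tfrac c2,\tfrac{c+1}2;z\right)*f(z)=z+\sum_{n=2}^\infty\frac{(a)_{n-1}\left(\frac b2\right)_{n-1}\left(\frac{b+1}2\right)_{n-1}}{\left(\frac c2\right)_{n-1}\left(\frac{c+1}2\right)_{n-1}(1)_{n-1}}\,a_nz^n.$$ ${}_2F_1(a,b;c;z)$ is the Gauss hypergeometric function, i.e. $\sum_{n\ge0}\frac{(a)_n(b)_n}{(c)_n(1)_n}z^n$ for $|z|<1$, continued analytically to $\mathbb{C}\setminus[1,\infty)$ (so its value at $-1$ makes sense). *)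

(* Defs.v *)
From HB Require Import structures.
From mathcomp Require Import all_boot all_order all_algebra.
From mathcomp Require Import complex.
From mathcomp Require Import all_classical all_reals all_analysis.

Set Implicit Arguments.
Unset Strict Implicit.
Unset Printing Implicit Defensive.

Import Order.TTheory GRing.Theory Num.Theory.
Import numFieldNormedType.Exports.

Local Open Scope classical_set_scope.
Local Open Scope ring_scope.

(* R[i] packed as a numClosedFieldType, so that it receives the norm topology
   of [numFieldNormedType]. *)
Definition Cx (R : realType) : numClosedFieldType := R[i].

Definition unit_disc (R : realType) : set (Cx R) := [set z | `|z| < 1].

Definition slit_plane (R : realType) : set (Cx R) :=
  ~` [set x%:C%C | x in `[1, +oo[%classic].

(* In the partial order of R[i], [0 < r] forces r to be real. *)
Definition pseries_on (R : realType) (u : nat -> Cx R) (z0 r : Cx R)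
    (f : Cx R -> Cx R) : Prop :=
  forall z, `|z - z0| < r ->
    series (fun n => u n * (z - z0) ^+ n) @ \oo --> f z.

Definition analytic_on (R : realType) (U : set (Cx R)) (f : Cx R -> Cx R) : Prop :=
  forall z0, U z0 -> exists2 r : Cx R, 0 < r & exists u, pseries_on u z0 r f.

(* Being the sum of a power series on the unit disc, such an f is analytic
   there; its values outside the disc are irrelevant. *)
Definition classA (R : realType) (f : Cx R -> Cx R) : Prop :=
  exists u : nat -> Cx R, [/\ u 0%N = 0, u 1%N = 1 & pseries_on u 0 1 f].

(* [f^`()] is the complex derivative.  The quotient in the definition requires
   f' to have no zero in the disc; since x / 0 = 0 in MathComp fields, this is
   spelled out. *)
Definition UCV (R : realType) (f : Cx R -> Cx R) : Prop :=
  [/\ classA f,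
      forall z, unit_disc z -> f^`()%classic z != 0 &
      forall z zeta, unit_disc z -> unit_disc zeta ->
        0 < complex.Re (1 + (z - zeta) * f^`(2)%classic z / f^`()%classic z)].

Definition classR (R : realType) (beta : R) (f : Cx R -> Cx R) : Prop :=
  classA f /\
  exists phi : R, forall z, unit_disc z ->
    0 < complex.Re ((cos phi +i* sin phi)%C * (f^`()%classic z - beta%:C%C)).

Definition pochhammer (K : pzRingType) (x : K) (n : nat) : K :=
  \prod_(k < n) (x + k%:R).

Definition hyp3F2_coef (R : realType) (a b c d e : Cx R) (n : nat) : Cx R :=
  pochhammer a n * pochhammer b n * pochhammer c n /
  (pochhammer d n * pochhammer e n * pochhammer 1 n).

Definition hyp2F1_coef (R : realType) (a b c : Cx R) (n : nat) : Cx R :=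
  pochhammer a n * pochhammer b n / (pochhammer c n * pochhammer 1 n).

(* F is 2F1(a, b; c; .) on C \ [1, oo): the Gauss series on the unit disc and
   its analytic continuation elsewhere, which is unique since the slit plane is
   connected. *)
Definition is_hyp2F1 (R : realType) (a b c : Cx R) (F : Cx R -> Cx R) : Prop :=
  analytic_on (@slit_plane R) F /\ pseries_on (hyp2F1_coef a b c) 0 1 F.

Definition taylor_coef (R : realType) (f : Cx R -> Cx R) (n : nat) : Cx R :=
  f^`(n)%classic 0 / n`!%:R.

(* The term of index n below is the one of degree n + 2. *)
Definition clausen_op (R : realType) (a b c : Cx R) (f : Cx R -> Cx R) :
    Cx R -> Cx R := fun z =>
  z + limn (series (fun n =>
    hyp3F2_coef a (b / 2) ((b + 1) / 2) (c / 2) ((c + 1) / 2) n.+1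
    * taylor_coef f n.+2 * z ^+ n.+2)).

(* Euler's integral, used for x > 0 only. *)
Definition Gamma (R : realType) (x : R) : R :=
  \int[lebesgue_measure]_(t in `]0, +oo[) (t `^ (x - 1) * expR (- t)).

Definition cabs (R : realType) (z : Cx R) : R := complex.Re `|z|.

(* Main.v *)
(* Write A = |a|, B = |b| and t_n = (A)_n (B)_2n / ((c)_2n n!), which bounds the modulus of the
   n-th coefficient of the kernel, since (b/2)_n ((b+1)/2)_n = (b)_2n / 4^n.  For f in R(beta),
   Caratheodory's inequality gives n |a_n| <= 2 (1 - beta), and a function z + sum d_n z^n is
   uniformly convex as soon as sum n (2n - 1) |d_n| <= 1; so it is enough that
   sum (2n + 1) t_n <= 1 / (2 (1 - beta)) + 1.

   The left-hand side of the assumption is an upper bound for that sum: since n t_n is a multiple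
   of t_(n-1) with (A, B, c) replaced by (A + 1, B + 2, c + 2), this reduces to
   sum t_n <= Gamma(c) Gamma(c-A-B) / (Gamma(c-A) Gamma(c-B)) 2F1(A, B; c - A; -1).
   The classical proof integrates t^(B-1) (1 - t)^(c-B-A-1) (1 + t)^(-A).  Here the Beta integral
   is replaced by series: 2F1(A, B + n; c + n; 1) is computed from 2F1(A, B; c; 1) by contiguity, a
   double series is rearranged along its diagonals using
   (1 - t)^(-A) (1 + t)^(-A) = (1 - t^2)^(-A), and 2F1(A, B; c; 1) is at most the Gamma quotient.
   Convergence at -1 may be conditional, so the rearrangement is made at -x with x < 1, and x
   tends to 1; in particular only the continuity at -1 of the analytic continuation is used. *)
Require Import Defs.
From HB Require Import structures.
From mathcomp Require Import all_boot all_order all_algebra.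
From mathcomp Require Import complex.
From mathcomp Require Import all_classical all_reals all_analysis.
From mathcomp Require Import measurable_realfun zify ring lra.

Set Implicit Arguments.
Unset Strict Implicit.
Unset Printing Implicit Defensive.

Import Order.TTheory GRing.Theory Num.Theory.
Import numFieldNormedType.Exports.

Local Open Scope classical_set_scope.
Local Open Scope ring_scope.

(** * Pochhammer symbols and series of real numbers *)

Section Pochhammer.
Variable K : comPzRingType.
Implicit Types x : K.

Lemma pochhammer0 x : pochhammer x 0 = 1.
Proof. by rewrite /pochhammer big_ord0. Qed.

Lemma pochhammerS x n : pochhammer x n.+1 = pochhammer x n * (x + n%:R).
Proof. by rewrite /pochhammer big_ord_recr. Qed.

Lemma pochhammerSl x n : pochhammer x n.+1 = x * pochhammer (x + 1) n.
Proof.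
rewrite /pochhammer big_ord_recl addr0; congr (_ * _).
by apply: eq_bigr => i _; rewrite lift0 -addrA nat1r.
Qed.

Lemma pochhammer1 n : pochhammer (1 : K) n = n`!%:R.
Proof.
elim: n => [|n ih]; first by rewrite pochhammer0.
by rewrite pochhammerS ih factS natrM mulrC nat1r.
Qed.

End Pochhammer.

Lemma pochhammer_gt0 (R : numDomainType) (x : R) n : 0 < x -> 0 < pochhammer x n.
Proof.
by move=> x0; apply: prodr_gt0 => i _; rewrite ltr_wpDr.
Qed.

Section RealSeries.
Variable R : realType.
Implicit Types u t y g : R^nat.

(** A Kummer-type test: each step spends [e * t k] out of the nonnegative budget [y], so e times the
    sum of t beyond [n0] never exceeds [y n0]. *)
Lemma telescoping_cvg_series t y n0 e : 0 < e ->
  (forall k, 0 <= t k) -> (forall k, 0 <= y k) ->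
  (forall k, (n0 <= k)%N -> y k.+1 + e * t k <= y k) ->
  cvgn (series t).
Proof.
move=> e0 t0 y0 yS; apply: nondecreasing_is_cvgn.
  by apply/nondecreasing_seqP => n; rewrite seriesSr lerDl.
have bnd n : y (n0 + n)%N + e * series t (n0 + n)%N <= y n0 + e * series t n0.
  elim: n => [|n ih]; first by rewrite addn0.
  rewrite addnS seriesSr mulrDr; apply: le_trans ih.
  by have := yS (n0 + n)%N (leq_addr _ _); lra.
exists (e^-1 * (y n0 + e * series t n0)) => _ [n _ <-].
rewrite ler_pdivlMl//.
apply: (@le_trans _ _ (e * series t (n0 + n)%N)).
  rewrite ler_pM2l//; apply: nondecreasing_series; last exact: leq_addl.
  by move=> k _ _; exact: t0.
by have := bnd n; have := y0 (n0 + n)%N; lra.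
Qed.

Lemma dominated_series u g : (forall n, `|u n| <= g n) ->
  cvgn (series g) -> cvgn (series u).
Proof.
move=> ug cg; apply: normed_cvg.
apply: (series_le_cvg _ _ ug cg) => n; first exact: normr_ge0.
exact: le_trans (ug n).
Qed.

Lemma dominated_series_tail u g M : (forall n, `|u n| <= g n) ->
  cvgn (series g) ->
  `|limn (series u) - series u M| <= limn (series g) - series g M.
Proof.
move=> ug cg; have cu := dominated_series ug cg.
have c1 : (fun n => `|series u n - series u M|) @ \oo
    --> `|limn (series u) - series u M|.
  by apply: cvg_norm; apply: cvgB => //; exact: cvg_cst.
have c2 : (fun n => series g n - series g M) @ \oo
    --> limn (series g) - series g M.
  by apply: cvgB => //; exact: cvg_cst.
apply: (ler_cvg_to c1 c2).
near=> n.
have Mn : (M <= n)%N by near: n; exact: nbhs_infty_ge.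
by rewrite !sub_series_geq//; apply: le_trans (ler_norm_sum _ _ _) _; exact: ler_sum.
Unshelve. all: by end_near. Qed.

Lemma cvg_series_finite (F : nat -> R^nat) (l : R^nat) M :
  (forall n, F ^~ n @ \oo --> l n) ->
  (fun N => series (F N) M) @ \oo --> series l M.
Proof.
move=> Fl; elim: M => [|M ih].
  rewrite /series /= big_geq//; under eq_fun do rewrite big_geq//.
  exact: cvg_cst.
under eq_fun do rewrite seriesSr; rewrite seriesSr.
exact: cvgD.
Qed.

(** Dominated convergence for series: beyond a cut M both sums differ from their partial sums by at
    most the tail of g, and below M there are finitely many terms. *)
Lemma tannery (F : nat -> R^nat) (l g : R^nat) :
  (forall N n, `|F N n| <= g n) -> cvgn (series g) ->
  (forall n, F ^~ n @ \oo --> l n) ->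
  (fun N => limn (series (F N))) @ \oo --> limn (series l).
Proof.
move=> Fg cg Fl.
have lg n : `|l n| <= g n.
  have c1 : (fun N => `|F N n|) @ \oo --> `|l n| by exact: cvg_norm (Fl n).
  have c2 : (fun _ : nat => g n) @ \oo --> g n by exact: cvg_cst.
  by apply: (ler_cvg_to c1 c2); near=> N; exact: Fg.
apply/cvgrPdist_lt => e e0.
have [M _ HM] : \forall M \near \oo, limn (series g) - series g M < e / 4.
  have := cg => /cvgrPdist_lt /(_ (e / 4)) /(_ _)/=.
  rewrite divr_gt0// => /(_ isT); apply: filterS => M.
  exact: le_lt_trans (ler_norm _).
have {}HM := HM M (leqnn M).
have := cvg_series_finite (M := M) Fl => /cvgrPdist_lt /(_ (e / 4)).
rewrite divr_gt0// => /(_ isT); apply: filterS => N HN.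
have h1 := dominated_series_tail M lg cg.
have h2 := dominated_series_tail M (Fg N) cg.
have -> : limn (series l) - limn (series (F N)) =
  (limn (series l) - series l M) + (series l M - series (F N) M)
   - (limn (series (F N)) - series (F N) M) by ring.
apply: le_lt_trans (ler_normB _ _) _.
apply: le_lt_trans (lerD (ler_normD _ _) (lexx _)) _.
by lra.
Unshelve. all: by end_near. Qed.

Lemma cvg_exprn u (l : R) n : u @ \oo --> l -> (fun j => u j ^+ n) @ \oo --> l ^+ n.
Proof.
move=> ul.
apply: (@cvg_comp _ _ _ u (fun y : R => y ^+ n) _ (nbhs l)); first exact: ul.
exact: exprn_continuous.
Qed.

Lemma limn_series_finite u N : (forall n, (N <= n)%N -> u n = 0) ->
  limn (series u) = series u N.
Proof.
move=> u0; apply: cvg_lim => //; apply: cvg_near_cst.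
near=> n; have Nn : (N <= n)%N by near: n; exact: nbhs_infty_ge.
apply/eqP; rewrite -subr_eq0 sub_series_geq// big_nat_cond big1// => i.
by rewrite andbT => /andP[+ _]; exact: u0.
Unshelve. all: by end_near. Qed.

End RealSeries.

(** * Gauss's series at 1 *)

Section Gauss.
Variable R : realType.
Implicit Types a b c : R.

Definition gauss_term a b c k : R :=
  pochhammer a k * pochhammer b k / (pochhammer c k * k`!%:R).

(* 2F1(a, b; c; 1). *)
Definition gauss_sum a b c : R := limn (series (gauss_term a b c)).

Lemma fact_neq0 k : (k`!%:R : R) != 0.
Proof. by rewrite pnatr_eq0 -lt0n fact_gt0. Qed.

Lemma factS_natr k : ((k.+1)`!%:R : R) = (k%:R + 1) * k`!%:R.
Proof. by rewrite factS natrM -natr1. Qed.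

Lemma natr1_gt0 k : 0 < k%:R + 1 :> R.
Proof. by rewrite ltr_wpDl. Qed.

Lemma pochhammerD1 (x : R) k : 0 < x ->
  pochhammer (x + 1) k = pochhammer x k * (x + k%:R) / x.
Proof.
by move=> x0; rewrite -pochhammerS pochhammerSl mulrAC divff ?mul1r// gt_eqF.
Qed.

Lemma gauss_term_gt0 a b c k : 0 < a -> 0 < b -> 0 < c -> 0 < gauss_term a b c k.
Proof.
by move=> *; rewrite divr_gt0 ?mulr_gt0 ?pochhammer_gt0 ?ltr0n ?fact_gt0.
Qed.

Lemma gauss_termS a b c k : 0 < c ->
  gauss_term a b c k.+1
  = gauss_term a b c k * ((a + k%:R) * (b + k%:R)) / ((c + k%:R) * (k%:R + 1)).
Proof.
move=> c0; rewrite /gauss_term !pochhammerS factS_natr; field.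
rewrite fact_neq0 !gt_eqF ?pochhammer_gt0 ?natr1_gt0//.
by rewrite ltr_wpDr.
Qed.

(** This increment of k times the k-th term drives both the convergence at 1 and the contiguous
    relations; for a + b < c it is eventually negative. *)
Lemma gauss_term_telescope a b c k : 0 < c ->
  k.+1%:R * gauss_term a b c k.+1 - k%:R * gauss_term a b c k
  = gauss_term a b c k * (a * b - (c - a - b) * k%:R) / (c + k%:R).
Proof.
move=> c0; rewrite gauss_termS// -natr1; field.
by rewrite !gt_eqF ?natr1_gt0// ltr_wpDr.
Qed.

(** Raabe's test: k times the k-th term eventually drops by at least (c - a - b) / 4 times that
    term. *)
Lemma is_cvg_gauss a b c : 0 < a -> 0 < b -> a + b < c ->
  cvgn (series (gauss_term a b c)).
Proof.
move=> a0 b0 abc; have c0 : 0 < c by lra.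
set d := c - a - b; have d0 : 0 < d by rewrite /d; lra.
(* From [n0] on, k >= c and d k >= 2 a b, so (a b - d k) / (c + k) is at most - (d k / 2) / (2 k) =
   - d / 4. *)
have [n0 n0P] : exists n0 : nat, 2 * a * b / d + c <= n0%:R.
  exists (Num.bound (2 * a * b / d + c)); apply/ltW/archi_boundP.
  by rewrite addr_ge0 ?divr_ge0 ?mulr_ge0 ?ltW.
apply: (@telescoping_cvg_series _ _
  (fun k => k%:R * gauss_term a b c k) n0 (d / 4)) => [|k|k|k n0k].
- by rewrite divr_gt0.
- exact/ltW/gauss_term_gt0.
- by rewrite mulr_ge0// ltW// gauss_term_gt0.
have kP : 2 * a * b / d + c <= k%:R by rewrite (le_trans n0P)// ler_nat.
have ck : c <= k%:R.
  by apply: le_trans kP; rewrite lerDr divr_ge0 ?mulr_ge0 ?ltW.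
have abk : 2 * a * b <= d * k%:R.
  by rewrite [d * _]mulrC -ler_pdivrMr//; apply: le_trans kP; rewrite lerDl ltW.
have ck0 : 0 < c + k%:R by rewrite ltr_wpDr.
rewrite -subr_le0 -addrA [X in _ + X]addrC addrA gauss_term_telescope//.
rewrite -mulrA [d / 4 * _]mulrC -mulrDr pmulr_rle0 ?gauss_term_gt0//.
rewrite addrC -lerBrDr sub0r -mulNr ler_pdivlMr// -/d.
have : d * c <= d * k%:R by rewrite ler_pM2l.
lra.
Qed.

(** The sequence is nonnegative and eventually nonincreasing, so it has a limit; a positive limit
    would make the convergent Gauss series dominate a multiple of the harmonic one. *)
Lemma cvg_mul_gauss_term a b c : 0 < a -> 0 < b -> a + b < c ->
  (fun k => k%:R * gauss_term a b c k) @ \oo --> 0.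
Proof.
move=> a0 b0 abc; have c0 : 0 < c by lra.
set y := fun k => _.
have y0 k : 0 <= y k by rewrite /y mulr_ge0// ltW// gauss_term_gt0.
have [n0 n0P] : exists n0 : nat, a * b / (c - a - b) <= n0%:R.
  exists (Num.bound (a * b / (c - a - b))); apply/ltW/archi_boundP.
  by rewrite divr_ge0 ?mulr_ge0 ?ltW//; lra.
have yS k : (n0 <= k)%N -> y k.+1 <= y k.
  move=> n0k; rewrite -subr_le0 gauss_term_telescope// -mulrA.
  rewrite pmulr_rle0 ?gauss_term_gt0// pmulr_lle0 ?invr_gt0 ?ltr_wpDr//.
  rewrite subr_le0 [X in _ <= X]mulrC -ler_pdivrMr; last lra.
  by rewrite (le_trans n0P)// ler_nat.
have yS' m k : (n0 <= k)%N -> y (k + m)%N <= y k.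
  move=> n0k; elim: m => [|m ih]; first by rewrite addn0.
  by rewrite addnS; apply: le_trans ih; apply: yS; rewrite (leq_trans n0k)// leq_addr.
have cy : cvgn y.
  apply: (@near_nonincreasing_is_cvgn _ y 0).
    near=> n => m nm; rewrite -(subnKC nm) yS'//.
    by near: n; exact: nbhs_infty_ge.
  by near=> n; exact: y0.
suff -> : 0 = limn y by [].
apply/eqP; rewrite eq_le; apply/andP; split; first by apply: limr_ge => //; near=> n.
rewrite leNgt; apply/negP => L0.
apply: (@dvg_harmonic R).
(* The first summand serves the indices k > n0; the inverses of the first n0 + 1 terms extend the
   comparison down to k = 0. *)
pose M := (limn y)^-1 + \sum_(j < n0.+1) (gauss_term a b c j)^-1.
have M0 : 0 < M.
  rewrite ltr_wpDr ?invr_gt0// sumr_ge0// => j _.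
  by rewrite invr_ge0 ltW// gauss_term_gt0.
apply: (@series_le_cvg _ _ (M *: gauss_term a b c)) => [k|k|k|].
- exact: harmonic_ge0.
- by rewrite mulr_ge0 ?ltW// gauss_term_gt0.
- have [kn0|n0k] := ltnP k n0.+1.
    apply: (@le_trans _ _ 1); first by rewrite invf_le1// ler1n.
    rewrite -ler_pdivrMr ?gauss_term_gt0// div1r /M (bigD1 (Ordinal kn0))//=.
    rewrite addrCA lerDl addr_ge0 ?invr_ge0 ?(ltW L0)// sumr_ge0// => j _.
    by rewrite invr_ge0 ltW// gauss_term_gt0.
  have k0 : 0 < k%:R :> R by rewrite ltr0n (leq_trans _ n0k).
  apply: (@le_trans _ _ ((limn y)^-1 * gauss_term a b c k)).
    rewrite ler_pdivlMl// /= -natr1.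
    apply: (@le_trans _ _ (limn y / k%:R)).
      by rewrite ler_pM2l// lef_pV2 ?posrE ?natr1_gt0// lerDl.
    rewrite ler_pdivrMr// mulrC; apply: limr_le => //.
    by near=> n; rewrite -(subnKC (m := k) (n := n)) ?yS' ?(ltnW n0k)//; near: n;
      exact: nbhs_infty_ge.
  rewrite ler_pM2r ?gauss_term_gt0// lerDl sumr_ge0// => j _.
  by rewrite invr_ge0 ltW// gauss_term_gt0.
- by apply: is_cvg_seriesZ; exact: is_cvg_gauss.
Unshelve. all: by end_near. Qed.

(** The partial sums differ by e times the boundary term n t_n, which tends to 0. *)
Lemma telescope_gauss a b c (u v : R^nat) e : 0 < a -> 0 < b -> a + b < c ->
  cvgn (series u) -> cvgn (series v) ->
  (forall k, u k - v k = e * (k.+1%:R * gauss_term a b c k.+1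
                              - k%:R * gauss_term a b c k)) ->
  limn (series u) = limn (series v).
Proof.
move=> a0 b0 abc cu cv uv; apply/eqP; rewrite -subr_eq0; apply/eqP.
have c1 : series u n - series v n @[n --> \oo] --> limn (series u) - limn (series v).
  exact: cvgB.
suff c2 : series u n - series v n @[n --> \oo] --> 0.
  by rewrite -(cvg_lim _ c1)//; exact: cvg_lim.
have -> : (fun n => series u n - series v n)
    = (fun n => e * (n%:R * gauss_term a b c n)).
  apply/funext => n; rewrite /series /= -sumrB.
  under eq_bigr do rewrite uv.
  by rewrite -big_distrr/= (telescope_sumr (fun k => k%:R * gauss_term a b c k))// mul0r subr0.
by rewrite -[X in _ --> X](mulr0 e); apply: cvgM; [exact: cvg_cst|exact: cvg_mul_gauss_term].
Qed.

Lemma limn_seriesZ e (u : R^nat) : cvgn (series u) ->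
  limn (series (fun k => e * u k)) = e * limn (series u).
Proof. exact: lim_seriesZ. Qed.

Lemma is_cvg_seriesM e (u : R^nat) : cvgn (series u) ->
  cvgn (series (fun k => e * u k)).
Proof. exact: is_cvg_seriesZ. Qed.

(** Telescoping with certificate c / b. Moving b and c together is what the rearrangement along
    diagonals requires. *)
Lemma gauss_sum_contiguous_bc a b c : 0 < a -> 0 < b -> a + b < c ->
  c * gauss_sum a b c = (c - a) * gauss_sum a (b + 1) (c + 1).
Proof.
move=> a0 b0 abc.
have b10 : 0 < b + 1 by lra.
have abc1 : a + (b + 1) < c + 1 by lra.
have c1 := is_cvg_gauss a0 b0 abc.
have c2 := is_cvg_gauss a0 b10 abc1.
rewrite -!limn_seriesZ//.
apply: (@telescope_gauss a b c _ _ (c / b)) => //; try exact: is_cvg_seriesM.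
move=> k; rewrite gauss_term_telescope; last lra.
have -> : gauss_term a (b + 1) (c + 1) k
    = gauss_term a b c k * ((b + k%:R) * c) / (b * (c + k%:R)).
  rewrite /gauss_term !pochhammerD1//; last lra.
  field; rewrite fact_neq0 !gt_eqF// ?pochhammer_gt0 ?ltr_wpDr//; lra.
field; rewrite !gt_eqF// ltr_wpDr//; lra.
Qed.

(** Telescoping with certificate - c. Moving c alone serves the comparison with the Gamma
    quotient. *)
Lemma gauss_sum_contiguous_c a b c : 0 < a -> 0 < b -> a + b < c ->
  c * (c - a - b) * gauss_sum a b c = (c - a) * (c - b) * gauss_sum a b (c + 1).
Proof.
move=> a0 b0 abc.
have abc1 : a + b < c + 1 by lra.
have c1 := is_cvg_gauss a0 b0 abc.
have c2 := is_cvg_gauss a0 b0 abc1.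
rewrite -!limn_seriesZ//.
apply: (@telescope_gauss a b c _ _ (- c)) => //; try exact: is_cvg_seriesM.
move=> k; rewrite gauss_term_telescope; last lra.
have -> : gauss_term a b (c + 1) k = gauss_term a b c k * c / (c + k%:R).
  rewrite /gauss_term !pochhammerD1//; last lra.
  field; rewrite fact_neq0 !gt_eqF// ?pochhammer_gt0 ?ltr_wpDr//; lra.
field; rewrite !gt_eqF// ltr_wpDr//; lra.
Qed.

End Gauss.

(** * Coefficients of (1 + x t)^(-a) (1 - t)^(-a) *)

Section BinomialProduct.
Variables (R : realType) (a : R).
Hypothesis a0 : 0 < a.
Implicit Types x : R.

(* The coefficients of (1 - t)^(-a). *)
Definition binom_coef (a : R) k : R := pochhammer a k / k`!%:R.

Lemma binom_coef0 : binom_coef a 0 = 1.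
Proof. by rewrite /binom_coef pochhammer0 fact0 divr1. Qed.

Lemma binom_coefS (d : R) k :
  (k%:R + 1) * binom_coef d k.+1 = (k%:R + d) * binom_coef d k.
Proof.
rewrite /binom_coef pochhammerS factS_natr; field.
by rewrite fact_neq0 gt_eqF// natr1_gt0.
Qed.

Lemma binom_coef_gt0 k : 0 < binom_coef a k.
Proof. by rewrite divr_gt0 ?pochhammer_gt0// ltr0n fact_gt0. Qed.

(* The coefficients of (1 + x t)^(-a) (1 - t)^(-a). *)
Definition binom_prod x m : R :=
  \sum_(n < m.+1) binom_coef a n * (- x) ^+ n * binom_coef a (m - n).

(* Coefficients of (1 - t)(1 + x t) P' = a (1 - x + 2 x t) P, where U and V below come from
   the derivatives of the two factors. *)
Lemma binom_prod_rec x m :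
  (m%:R + 2) * binom_prod x m.+2
  = (1 - x) * (m%:R + 1 + a) * binom_prod x m.+1 + x * (m%:R + 2 * a) * binom_prod x m.
Proof.
pose e n := binom_coef a n * (- x) ^+ n.
pose P m := \sum_(n < m.+1) e n * binom_coef a (m - n).
pose U m := \sum_(n < m.+1) (m - n)%:R * (e n * binom_coef a (m - n)).
pose V m := \sum_(n < m.+1) n%:R * (e n * binom_coef a (m - n)).
have US k : U k.+1 = U k + a * P k.
  rewrite /U big_ord_recr/= subnn mul0r addr0 /P big_distrr -big_split/=.
  apply: eq_bigr => i _; have ik : (i <= k)%N by rewrite -ltnS.
  rewrite subSn// -natr1.
  by rewrite mulrCA binom_coefS; ring.
have VS k : V k.+1 = - x * (V k + a * P k).
  rewrite /V big_ord_recl [X in X + _](_ : _ = 0) ?add0r; last by rewrite mul0r.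
  rewrite /P [a * _]big_distrr -big_split big_distrr; apply: eq_bigr => i _.
  rewrite lift0 subSS /e exprS -natr1 [LHS]mulrA [X in X * _ = _]mulrA.
  by rewrite binom_coefS /=; ring.
have UV k : U k + V k = k%:R * P k.
  rewrite /U /V /P -big_split big_distrr /=; apply: eq_bigr => i _.
  have ik : (i <= k)%N by rewrite -ltnS.
  by rewrite -mulrDl -natrD subnK.
rewrite -[binom_prod x m.+2]/(P m.+2) -[binom_prod x m.+1]/(P m.+1).
rewrite -[binom_prod x m]/(P m).
have E2 := UV m.+2; have E1 := UV m.+1; have E0 := UV m.
rewrite (US m.+1) (VS m.+1) in E2.
rewrite -!natr1 in E2 E1.
(* U - x V equals (1 - x)(U + V) + (x U - V), and one step of [US] and [VS] turns x U - V into x (U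
   + V + 2 a P) at index m. *)
have E : U m.+1 - x * V m.+1 = (1 - x) * ((m%:R + 1) * P m.+1) + x * (m%:R + 2 * a) * P m.
  rewrite -E1; have -> : x * (m%:R + 2 * a) * P m = x * (m%:R * P m) + x * a * P m *+ 2 by ring.
  rewrite -E0; move: (US m) (VS m) => -> ->; ring.
have -> : (m%:R + 2) * P m.+2 = (m%:R + 1 + 1) * P m.+2 by ring.
rewrite -E2.
have -> : U m.+1 + a * P m.+1 + - x * (V m.+1 + a * P m.+1)
  = U m.+1 - x * V m.+1 + (1 - x) * a * P m.+1 by ring.
rewrite E; ring.
Qed.

Lemma binom_prod0 x : binom_prod x 0 = 1.
Proof. by rewrite /binom_prod big_ord1 binom_coef0 expr0 !mulr1. Qed.

Lemma binom_prod1 x : binom_prod x 1 = (1 - x) * a.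
Proof.
rewrite /binom_prod big_ord_recr big_ord1 /= expr0 expr1 subn0 subnn binom_coef0.
have -> : binom_coef a 1 = a.
  by rewrite /binom_coef pochhammerS pochhammer0 addr0 mul1r -[1`!]/1%N divr1.
ring.
Qed.

(* (1 + x t)(1 - t) = 1 - ((1 - x) t + x t^2), so the coefficients are
   nonnegative; the recurrence propagates the upper bound once a is at least 1. *)
Lemma binom_prod_bound x m : 0 <= x <= 1 ->
  0 <= binom_prod x m <= binom_coef (Num.max a 1) m.
Proof.
move=> /andP[x0 x1]; set d := Num.max a 1.
have d1 : 1 <= d by rewrite le_max lexx orbT.
have ad : a <= d by rewrite le_max lexx.
have dm k : 0 < binom_coef d k.
  by rewrite divr_gt0 ?pochhammer_gt0 ?ltr0n ?fact_gt0//; lra.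
suff : (0 <= binom_prod x m <= binom_coef d m)
    /\ (0 <= binom_prod x m.+1 <= binom_coef d m.+1) by case.
elim: m => [|m [/andP[p0 pq] /andP[p0' pq']]].
  rewrite binom_prod0 binom_prod1 /binom_coef !pochhammerS !pochhammer0.
  rewrite -[0`!]/1%N -[1`!]/1%N !divr1 lexx ler01 addr0 mul1r mulr_ge0 ?(ltW a0) ?subr_ge0//=; split=> //.
  nra.
split; first by rewrite p0' pq'.
have m0 : 0 <= m%:R :> R by [].
have m2 : 0 < m%:R + 2 :> R by lra.
apply/andP; split.
  by rewrite -(pmulr_rge0 _ m2) binom_prod_rec addr_ge0// !mulr_ge0// ?subr_ge0 ?addr_ge0 ?mulr_ge0 ?(ltW a0).
rewrite -(ler_pM2l m2) binom_prod_rec.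
have := binom_coefS d m.+1; rewrite -natr1.
have -> : m%:R + 1 + 1 = m%:R + 2 :> R by ring.
move=> ->.
have h1 : (1 - x) * (m%:R + 1 + a) * binom_prod x m.+1
    <= (1 - x) * (m%:R + 1 + d) * binom_coef d m.+1.
  rewrite -!mulrA ler_wpM2l ?subr_ge0// ler_pM ?addr_ge0 ?(ltW a0)//; lra.
have h2 : x * (m%:R + 2 * a) * binom_prod x m
    <= x * ((m%:R + 1 + d) * binom_coef d m.+1).
  rewrite -!mulrA ler_wpM2l//.
  apply: (@le_trans _ _ ((m%:R + 2 * d) * binom_coef d m)).
    by rewrite ler_pM ?addr_ge0 ?mulr_ge0 ?(ltW a0)//; lra.
  have m1 : 0 < m%:R + 1 :> R by lra.
  rewrite -(ler_pM2l m1) [leRHS]mulrCA binom_coefS [leRHS]mulrA [leLHS]mulrA (ler_pM2r (dm m)) -subr_ge0.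
  (* The gap between the two factors is d (d - 1), which is where d >= 1 enters. *)
  have -> : (m%:R + 1 + d) * (m%:R + d) - (m%:R + 1) * (m%:R + 2 * d)
    = d * (d - 1) :> R by ring.
  by rewrite mulr_ge0 ?subr_ge0//; lra.
apply: le_trans (lerD h1 h2) _.
by rewrite -!mulrA -mulrDl subrK mul1r.
Qed.

(** At x = 1 the product is (1 - t^2)^(-a): the middle term of the recurrence vanishes and even and
    odd indices decouple. *)
Lemma binom_prod_at1 j :
  binom_prod 1 j.*2 = binom_coef a j /\ binom_prod 1 j.*2.+1 = 0.
Proof.
elim: j => [|j [ihe iho]]; first by rewrite binom_prod0 binom_coef0 binom_prod1 subrr mul0r.
have h m : (m%:R + 2) * binom_prod 1 m.+2 = (m%:R + 2 * a) * binom_prod 1 m.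
  by rewrite binom_prod_rec; ring.
have m2 m : m%:R + 2 != 0 :> R by rewrite gt_eqF// ltr_wpDl.
rewrite doubleS; split.
  apply: (mulfI (m2 j.*2)); rewrite h ihe -muln2 natrM.
  have -> : (j%:R * 2 + 2) * binom_coef a j.+1 = 2 * ((j%:R + 1) * binom_coef a j.+1) by ring.
  by rewrite binom_coefS; ring.
by apply: (mulfI (m2 j.*2.+1)); rewrite h iho !mulr0.
Qed.

Lemma cvg_binom_prod (x_ : R^nat) x m : x_ @ \oo --> x ->
  (fun j => binom_prod (x_ j) m) @ \oo --> binom_prod x m.
Proof.
move=> xx; rewrite /binom_prod -(big_mkord xpredT (fun n => binom_coef a n * (- x) ^+ n * binom_coef a (m - n))).
under eq_fun do
  rewrite -(big_mkord xpredT (fun n => binom_coef a n * (- _) ^+ n * binom_coef a (m - n))).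
apply: (@cvg_series_finite _ (fun j n => binom_coef a n * (- x_ j) ^+ n * binom_coef a (m - n))) => n.
apply: cvgM; last exact: cvg_cst.
apply: cvgM; first exact: cvg_cst.
by apply: cvg_exprn; exact: cvgN.
Qed.

Lemma is_cvg_binom x : 0 <= x < 1 -> cvgn (series (fun n => binom_coef a n * x ^+ n)).
Proof.
move=> /andP[x0 x1].
(* Past [n0], k (1 - x) >= x a + 1, which says that k times the k-th term drops by at least the term
   itself. *)
have [n0 n0P] : exists n0 : nat, (x * a + 1) / (1 - x) <= n0%:R.
  exists (Num.bound ((x * a + 1) / (1 - x))); apply/ltW/archi_boundP.
  by rewrite divr_ge0 ?subr_ge0 ?addr_ge0 ?mulr_ge0 ?(ltW a0) ?(ltW x1).
have u0 k : 0 <= binom_coef a k * x ^+ k by rewrite mulr_ge0 ?exprn_ge0// ltW// binom_coef_gt0.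
apply: (@telescoping_cvg_series _ _
  (fun k => k%:R * (binom_coef a k * x ^+ k)) n0 1) => // [k|k n0k].
  exact: mulr_ge0.
have kP : x * a + 1 <= k%:R * (1 - x).
  by rewrite -ler_pdivrMr; [rewrite (le_trans n0P)// ler_nat|lra].
rewrite -natr1 mulrA binom_coefS exprS mul1r -subr_ge0.
have -> : k%:R * (binom_coef a k * x ^+ k) - ((k%:R + a) * binom_coef a k * (x * x ^+ k)
  + binom_coef a k * x ^+ k) = (binom_coef a k * x ^+ k) * (k%:R * (1 - x) - (x * a + 1)) by ring.
by rewrite mulr_ge0 ?subr_ge0.
Qed.

End BinomialProduct.

(** * Rearrangement linking the Gauss series at 1 and at -x *)

Section AlternatingGauss.
Variable R : realType.
Implicit Types a b c x : R.

Lemma pochhammerD x n k : pochhammer x (n + k) = pochhammer x n * pochhammer (x + n%:R) k.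
Proof.
elim: k => [|k ih]; first by rewrite addn0 pochhammer0 mulr1.
by rewrite addnS !pochhammerS ih natrD addrA mulrA.
Qed.

(** Rearrangement of a finite triangle by rows instead of diagonals: [e n] meets exactly the first N
    - n terms of its inner sum. *)
Lemma sum_triangle (e q w : R^nat) N :
  \sum_(m < N) w m * \sum_(n < m.+1) e n * q (m - n)%N
  = \sum_(n < N) e n * series (fun k => q k * w (n + k)%N) (N - n)%N.
Proof.
elim: N => [|N ih]; first by rewrite !big_ord0.
rewrite big_ord_recr ih [in RHS]big_ord_recr /= subSn// subnn.
rewrite [X in e N * X](_ : _ = q 0%N * w N); last first.
  by rewrite /series /= big_nat1 addn0.
rewrite [in LHS]big_ord_recr /= subnn mulrDr addrA; congr (_ + _); last by ring.
rewrite big_distrr -big_split /=; apply: eq_bigr => i _.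
have iN : (i <= N)%N by exact: ltnW.
by rewrite subSn// seriesSr subnKC//; ring.
Qed.

Lemma gauss_sum_shift a b c n : 0 < a -> 0 < b -> a + b < c ->
  gauss_sum a (b + n%:R) (c + n%:R)
  = gauss_sum a b c * pochhammer c n / pochhammer (c - a) n.
Proof.
move=> a0 b0 abc; have c0 : 0 < c by lra.
elim: n => [|n ih]; first by rewrite !addr0 !pochhammer0 mulr1 divr1.
have n0 : 0 <= n%:R :> R by [].
have cn : c - a + n%:R != 0 by rewrite gt_eqF//; lra.
have := @gauss_sum_contiguous_bc _ a (b + n%:R) (c + n%:R) a0.
rewrite ih -!addrA natr1 => h.
apply: (mulfI cn); have -> : c - a + n%:R = c + (n%:R - a) by ring.
rewrite -h; [|lra|lra].
rewrite !pochhammerS; field.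
by rewrite cn gt_eqF// pochhammer_gt0//; lra.
Qed.

(** For 0 < b < c this is the k-th moment of the Beta(b, c - b) law; it carries the Beta integral
    into series form. *)
Let poch_ratio b c k : R := pochhammer b k / pochhammer c k.

Lemma gauss_term_shift a b c n k : 0 < b -> 0 < c ->
  binom_coef a k * poch_ratio b c (n + k)
  = poch_ratio b c n * gauss_term a (b + n%:R) (c + n%:R) k.
Proof.
move=> b0 c0; rewrite /poch_ratio /binom_coef /gauss_term !pochhammerD; field.
by rewrite fact_neq0 !gt_eqF// pochhammer_gt0// ltr_wpDr.
Qed.

Lemma poch_ratio_gt0 b c n : 0 < b -> 0 < c -> 0 < poch_ratio b c n.
Proof. by move=> *; rewrite divr_gt0 ?pochhammer_gt0. Qed.

Lemma poch_ratio_le b c n k : 0 < b -> b < c -> poch_ratio b c (n + k) <= poch_ratio b c k.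
Proof.
move=> b0 bc; have c0 : 0 < c := lt_trans b0 bc.
elim: n => [//|n ih]; rewrite addSn; apply: le_trans ih.
rewrite /poch_ratio !pochhammerS invfM mulrACA ler_piMr ?(ltW (poch_ratio_gt0 _ _ _))//.
have n0 : 0 <= (n + k)%:R :> R by [].
by rewrite ler_pdivrMr ?mul1r; lra.
Qed.

(** Series form of the integral of t^n (1 - t)^(-a) against the Beta law: it equals 2F1 at 1 times
    the n-th moment with c lowered by a. *)
Lemma cvg_gauss_shift a b c n : 0 < a -> 0 < b -> a + b < c ->
  series (fun k => binom_coef a k * poch_ratio b c (n + k)) @ \oo
    --> gauss_sum a b c * poch_ratio b (c - a) n.
Proof.
move=> a0 b0 abc; have c0 : 0 < c by lra.
have n0 : 0 <= n%:R :> R by [].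
have cg : cvgn (series (gauss_term a (b + n%:R) (c + n%:R))).
  by apply: is_cvg_gauss => //; lra.
have -> : (fun k => binom_coef a k * poch_ratio b c (n + k))
    = (fun k => poch_ratio b c n * gauss_term a (b + n%:R) (c + n%:R) k).
  by apply/funext => k; rewrite gauss_term_shift.
have -> : gauss_sum a b c * poch_ratio b (c - a) n
    = poch_ratio b c n * gauss_sum a (b + n%:R) (c + n%:R).
  rewrite gauss_sum_shift// /poch_ratio; field.
  by rewrite !gt_eqF// pochhammer_gt0//; lra.
rewrite -limn_seriesZ//; exact: is_cvg_seriesM.
Qed.

(** Series form of integrating (1 + x t)^(-a) (1 - t)^(-a). After [sum_triangle], the inner sum
    attached to n has the limit given by [cvg_gauss_shift], and x < 1 makes the outer sum absolutely
    convergent. *)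
Lemma binom_prod_series a b c x : 0 < a -> 0 < b -> a + b < c ->
  0 <= x < 1 ->
  (fun N => series (fun m => poch_ratio b c m * binom_prod a x m) N) @ \oo -->
  gauss_sum a b c * limn (series (fun n => gauss_term a b (c - a) n * (- x) ^+ n)).
Proof.
move=> a0 b0 abc x01; have c0 : 0 < c by lra.
have bc : b < c by lra.
set H := gauss_sum a b c.
pose e n := binom_coef a n * (- x) ^+ n.
pose S n := series (fun k => binom_coef a k * poch_ratio b c (n + k)).
have Sl n : S n @ \oo --> H * poch_ratio b (c - a) n by exact: cvg_gauss_shift.
have T0 n i : 0 <= binom_coef a i * poch_ratio b c (n + i).
  by apply/ltW/mulr_gt0; [exact: binom_coef_gt0|exact: poch_ratio_gt0].
have S_ge0 n k : 0 <= S n k.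
  by rewrite /S /series/= sumr_ge0.
have S_le n k : S n k <= H * poch_ratio b (c - a) n.
  rewrite -(cvg_lim _ (Sl n))//; apply: nondecreasing_cvgn_le; last exact: cvgP (Sl n).
  by apply: nondecreasing_series => i _ _; exact: T0.
have L_le n : H * poch_ratio b (c - a) n <= H * poch_ratio b (c - a) 0.
  apply: (ler_cvg_to (Sl n) (Sl 0%N)); near=> k.
  rewrite /S /series/=; apply: ler_sum => i _.
  by rewrite ler_pM2l ?binom_coef_gt0// add0n poch_ratio_le.
(* The weighted error of replacing a truncated inner sum by its limit, set to 0 off the triangle; it
   vanishes as N grows and is dominated by a binomial series at x. *)
pose F N n := if (n < N)%N then e n * (H * poch_ratio b (c - a) n - S n (N - n)%N) else 0.
have eE n : `|e n| = binom_coef a n * x ^+ n.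
  rewrite /e normrM normrX normrN (ger0_norm (ltW (binom_coef_gt0 a0 n))).
  by case/andP: x01 => x0 _; rewrite (ger0_norm x0).
pose g n := H * poch_ratio b (c - a) 0 * (binom_coef a n * x ^+ n).
have cg : cvgn (series g) by apply: is_cvg_seriesM; exact: is_cvg_binom.
have e_dom n : `|e n * (H * poch_ratio b (c - a) n)| <= g n.
  rewrite normrM eE [leRHS]mulrC ler_wpM2l -?eE//.
  by rewrite ger0_norm// (le_trans (S_ge0 n 0%N)).
have Fg N n : `|F N n| <= g n.
  rewrite /F; case: ifP => _; last by rewrite normr0 (le_trans _ (e_dom n)).
  rewrite normrM eE [leRHS]mulrC ler_wpM2l -?eE//.
  rewrite ger0_norm ?subr_ge0//; apply: le_trans (L_le n).
  by rewrite lerBlDr lerDl.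
have F0 n : F ^~ n @ \oo --> (0 : R).
  (* After a shift by n + 1 the test n < N always succeeds, and the inner length becomes N + 1. *)
  rewrite -(cvg_shiftn n.+1).
  have -> : (fun N => F (N + n.+1)%N n)
      = (fun N => e n * (H * poch_ratio b (c - a) n - S n (N + 1)%N)).
    apply/funext => N; rewrite /F ifT; last by rewrite addnS ltnS leq_addl.
    by rewrite addnS subSn ?leq_addl// addnK addn1.
  have c1 : (fun N => S n (N + 1)%N) @ \oo --> H * poch_ratio b (c - a) n by rewrite cvg_shiftn.
  have : (fun N => e n * (H * poch_ratio b (c - a) n - S n (N + 1)%N)) @ \oo
      --> e n * (H * poch_ratio b (c - a) n - H * poch_ratio b (c - a) n).
    by apply: cvgM; [exact: cvg_cst|apply: cvgB; [exact: cvg_cst|exact: c1]].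
  by rewrite subrr mulr0.
have := tannery Fg cg F0.
have -> : limn (series (fun _ : nat => 0 : R)) = 0.
  by rewrite (@limn_series_finite _ _ 0)// /series/= big_geq.
have -> : (fun N => limn (series (F N)))
   = (fun N => series (fun n => e n * (H * poch_ratio b (c - a) n)) N
       - series (fun m => poch_ratio b c m * binom_prod a x m) N).
  apply/funext => N; rewrite (@limn_series_finite _ _ N); last first.
    by move=> n Nn; rewrite /F ltnNge Nn.
  rewrite !seriesEord /binom_prod /=.
  rewrite (sum_triangle e (binom_coef a) (poch_ratio b c)) -sumrB.
  by apply: eq_bigr => i _; rewrite /F ltn_ord mulrBr.
move=> D0.
have ce : cvgn (series (fun n => e n * (H * poch_ratio b (c - a) n))).
  exact: dominated_series e_dom cg.
have := cvgB ce D0; rewrite subr0.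
have -> : (series (fun n => e n * (H * poch_ratio b (c - a) n)) -
   (fun N => series (fun n => e n * (H * poch_ratio b (c - a) n)) N -
             series (fun m => poch_ratio b c m * binom_prod a x m) N))
  = (fun N => series (fun m => poch_ratio b c m * binom_prod a x m) N).
  by apply/funext => N /=; rewrite !fctE opprB addrC subrK.
have -> : (fun n => e n * (H * poch_ratio b (c - a) n))
    = (fun n => H * (gauss_term a b (c - a) n * (- x) ^+ n)).
  apply/funext => n; rewrite /e /binom_coef /poch_ratio /gauss_term; field.
  by rewrite fact_neq0 gt_eqF// pochhammer_gt0//; lra.
suff ch : cvgn (series (fun n => gauss_term a b (c - a) n * (- x) ^+ n)).
  by rewrite -(limn_seriesZ _ ch); apply.
(* H is at least the first term of its series, which is positive, so dividing by H recovers the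
   convergence of the series at -x. *)
have H0 : 0 < H.
  apply: (@lt_le_trans _ _ (S 0%N 1%N)); last first.
    by have := S_le 0%N 1%N; rewrite /poch_ratio !pochhammer0 divr1 mulr1.
  by rewrite /S /series/= big_nat1 mulr_gt0 ?binom_coef_gt0 ?poch_ratio_gt0.
suff -> : (fun n => gauss_term a b (c - a) n * (- x) ^+ n)
    = (fun n => H^-1 * (e n * (H * poch_ratio b (c - a) n))) by exact: is_cvg_seriesM.
apply/funext => n.
rewrite /e /binom_coef /poch_ratio /gauss_term; field.
by rewrite fact_neq0 !gt_eqF// pochhammer_gt0//; lra.
Unshelve. all: by end_near. Qed.

(** Let x = 1 - 1 / (j + 1) tend to 1 in [binom_prod_series]. The bound with d = max(a, 1) holds for
    all j at once, and its series converges because a + b < c and b + 1 < c; at x = 1 only the even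
    indices survive. *)
Lemma even_gauss_sum_le a b c (L : R) N : 0 < a -> 0 < b -> a + b < c -> b + 1 < c ->
  (fun j => limn (series (fun n =>
     gauss_term a b (c - a) n * (- (1 - harmonic j)) ^+ n))) @ \oo --> L ->
  \sum_(n < N) pochhammer a n * pochhammer b n.*2 / (pochhammer c n.*2 * n`!%:R)
  <= gauss_sum a b c * L.
Proof.
move=> a0 b0 abc bc1 cL; have c0 : 0 < c by lra.
set d := Num.max a 1.
have d0 : 0 < d by rewrite lt_max a0.
have dbc : d + b < c by rewrite -ltrBrDr gt_max; apply/andP; split; lra.
pose x_ j : R := 1 - harmonic j.
have x01 j : 0 <= x_ j < 1.
  by rewrite /x_ /= subr_ge0 ltrBlDr ltrDl invr_gt0 ltr0n invf_le1// ler1n.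
have cx : x_ @ \oo --> (1 : R).
  rewrite -[X in _ --> X]subr0; apply: cvgB; [exact: cvg_cst|exact: cvg_harmonic].
pose g m := poch_ratio b c m * binom_coef d m.
have gE : g = gauss_term d b c.
  apply/funext => m; have := @gauss_term_shift d b c 0 m b0 c0.
  by rewrite add0n /g mulrC => ->; rewrite !addr0 {1}/poch_ratio !pochhammer0 divr1 mul1r.
have cg : cvgn (series g) by rewrite gE; exact: is_cvg_gauss.
pose F j m := poch_ratio b c m * binom_prod a (x_ j) m.
have Fg j m : `|F j m| <= g m.
  have /andP[x0 x1] := x01 j.
  have /andP[p0 pd] : 0 <= binom_prod a (x_ j) m <= binom_coef d m.
    by apply: binom_prod_bound; rewrite // x0 ltW.
  have w0 := poch_ratio_gt0 m b0 c0.
  by rewrite ger0_norm /g ?ler_pM2l// mulr_ge0// ltW.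
have Fl m : F ^~ m @ \oo --> poch_ratio b c m * binom_prod a 1 m.
  by apply: cvgM; [exact: cvg_cst|exact: cvg_binom_prod].
have := tannery Fg cg Fl.
set G := fun j => limn (series _) in cL.
have -> : (fun j => limn (series (F j))) = (fun j => gauss_sum a b c * G j).
  by apply/funext => j; apply: cvg_lim => //; exact: binom_prod_series.
move=> c1.
have c2 : (fun j => gauss_sum a b c * G j) @ \oo --> gauss_sum a b c * L.
  by apply: cvgM; [exact: cvg_cst|exact: cL].
rewrite -(cvg_unique _ c1 c2)//.
pose l m := poch_ratio b c m * binom_prod a 1 m.
have lg m : `|l m| <= g m.
  have /andP[p0 pd] : 0 <= binom_prod a 1 m <= binom_coef d m.
    by apply: binom_prod_bound; rewrite // ler01 lexx.
  have w0 := poch_ratio_gt0 m b0 c0.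
  by rewrite ger0_norm /g ?ler_pM2l// mulr_ge0// ltW.
have l0 m : 0 <= l m.
  have /andP[p0 pd] : 0 <= binom_prod a 1 m <= binom_coef d m.
    by apply: binom_prod_bound; rewrite // ler01 lexx.
  by apply: mulr_ge0 => //; exact/ltW/poch_ratio_gt0.
have -> : \sum_(n < N) pochhammer a n * pochhammer b n.*2 / (pochhammer c n.*2 * n`!%:R)
    = series l N.*2.
  elim: N => [|N ih]; first by rewrite big_ord0 /series/= big_geq.
  have [pe po] := binom_prod_at1 a N.
  rewrite big_ord_recr ih doubleS !seriesSr /= -addrA; congr (_ + _).
  rewrite /l pe po mulr0 addr0 /poch_ratio /binom_coef; field.
  by rewrite fact_neq0 gt_eqF// pochhammer_gt0.
apply: nondecreasing_cvgn_le; first by apply: nondecreasing_series.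
exact: dominated_series lg cg.
Qed.

End AlternatingGauss.

(** * The Gamma function *)

Section GammaFunction.
Variable R : realType.
Implicit Types x t : R.
Notation mu := (@lebesgue_measure R).
Notation pos := (`]0%R, +oo[%classic : set R).

Definition gamma_integrand x t : R := t `^ (x - 1) * expR (- t).

Lemma gamma_integrand_ge0 x t : 0 <= gamma_integrand x t.
Proof. by rewrite mulr_ge0 ?powR_ge0 ?expR_ge0. Qed.

Lemma measurable_gamma_integrand x (D : set R) :
  measurable_fun D (gamma_integrand x).
Proof.
apply: measurable_funTS; apply: measurable_funM.
  exact: (@measurableT_comp _ _ _ _ _ _ (@powR R ^~ (x - 1))).
exact: (@measurableT_comp _ _ _ _ _ _ (@expR R)).
Qed.

Lemma measurable_EFin_gamma_integrand x (D : set R) :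
  measurable_fun D (EFin \o gamma_integrand x).
Proof. by apply/measurable_EFinP; exact: measurable_gamma_integrand. Qed.

(** Raise t <= y (1 + t / y) <= y e^(t / y) to the power y. *)
Lemma powR_expRN_le (y t : R) : 0 < y -> 0 <= t -> t `^ y <= y `^ y * expR t.
Proof.
move=> y0 t0; have -> : expR t = expR (t / y) `^ y.
  by rewrite -expRM divfK// gt_eqF.
rewrite -powRM ?expR_ge0 ?(ltW y0)//; apply: ge0_ler_powR.
- exact: ltW.
- by rewrite nnegrE.
- by rewrite nnegrE mulr_ge0 ?expR_ge0 ?(ltW y0).
apply: (@le_trans _ _ (y * (1 + t / y))).
  by rewrite mulrDr mulrC [y * (t / y)]mulrCA divff ?gt_eqF// mulr1 ?mul1r lerDr ltW.
by rewrite ler_pM2l// expR_ge1Dx.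
Qed.

Lemma gamma_integrable_gt1 x : 1 < x -> mu.-integrable pos (EFin \o gamma_integrand x).
Proof.
move=> x1; set y := x - 1; have y0 : 0 < y by rewrite subr_gt0.
(* t^y e^(-t/2) is at most (2 y)^y, and the last factor 2 cancels the rate 1/2 of the exponential
   density. *)
pose C := (2 * y) `^ y * 2.
have h0 : 0 < 2^-1 :> R by rewrite invr_gt0.
apply: (@le_integrable _ (measurableTypeR R) R mu pos _ _ (fun t => (C * exponential_pdf 2^-1 t)%:E)) => //.
- exact: measurable_EFin_gamma_integrand.
- move=> t; rewrite /= in_itv/= andbT => t0.
  rewrite lee_fin ger0_norm ?gamma_integrand_ge0//.
  rewrite exponential_pdfE ?(ltW t0)// ger0_norm; last first.
    by rewrite !mulr_ge0 ?powR_ge0 ?expR_ge0.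
  rewrite /C -mulrA mulVKf ?gt_eqF// /gamma_integrand -/y.
  have -> : expR (- t) = expR (- (t / 2)) * expR (- 2^-1 * t).
    by rewrite -expRD; congr expR; field.
  rewrite mulrA ler_pM2r ?expR_gt0//.
  rewrite expRN ler_pdivrMr ?expR_gt0//.
  have -> : t `^ y = 2 `^ y * (t / 2) `^ y.
    by rewrite -powRM ?divr_ge0 ?(ltW t0)//; congr (_ `^ _); field.
  have -> : (2 * y) `^ y = 2 `^ y * y `^ y by apply: powRM => //; exact: ltW.
  rewrite -mulrA ler_pM2l ?powR_gt0//.
  by rewrite powR_expRN_le// divr_ge0 ?(ltW t0).
have -> : (fun t => (C * exponential_pdf 2^-1 t)%:E)
   = (fun t => C%:E * (EFin \o exponential_pdf 2^-1) t)%E by [].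
apply: integrableZl => //.
apply: (@integrableS _ _ _ _ setT) => //.
exact: integrable_exponential_pdf.
Qed.

Let powR_expRN x t : R := t `^ x * - expR (- t).

Lemma is_derive_expRN t : is_derive t 1 (fun t : R => - expR (- t)) (expR (- t)).
Proof.
by apply: is_derive_eq; rewrite mulrN1 opprK.
Qed.

Lemma derivable_oo_LRcontinuousT (f df : R -> R) (a b : R) :
  (forall t, a <= t -> is_derive t 1 f (df t)) -> a < b ->
  derivable_oo_LRcontinuous f a b.
Proof.
move=> fd ab.
have fc t : a <= t -> {for t, continuous f}.
  move=> at0; apply: differentiable_continuous; apply/derivable1_diffP.
  by have [] := fd t at0.
split.
- move=> t /[!in_itv]/= /andP[/ltW at0 _]; by have [] := fd t at0.
- by apply: cvg_at_right_filter; exact: fc.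
- by apply: cvg_at_left_filter; apply: fc; exact: ltW.
Qed.

Lemma gamma_integrand_parts x (a b : R) : 0 < x -> 0 < a -> a < b ->
  (\int[mu]_(t in `[a, b]) (gamma_integrand (x + 1) t)%:E
   = (powR_expRN x b - powR_expRN x a)%:E
     + x%:E * \int[mu]_(t in `[a, b]) (gamma_integrand x t)%:E)%E.
Proof.

move=> x0 a0 ab; have b0 := lt_trans a0 ab.
have dpow y t : a <= t -> is_derive t 1 (@powR R ^~ y) (y * t `^ (y - 1)).
  by move=> at0; apply: is_derive1_powR; exact: lt_le_trans at0.
have dpowZ t : a <= t -> is_derive t 1 (fun t => x * t `^ (x - 1))
    (x * ((x - 1) * t `^ (x - 1 - 1))).
  by move=> at0; have := is_deriveZ x (dpow (x - 1) t at0).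
have dexp t : a <= t -> is_derive t 1 (fun t : R => expR (- t)) (- expR (- t)).
  by move=> _; apply: is_derive_eq; rewrite mulrN1.
have := @integration_by_parts R (@powR R ^~ x) (fun t => - expR (- t))
  (fun t => x * t `^ (x - 1)) (fun t => expR (- t)) a b ab
  (derivable_oo_LRcontinuous_within (derivable_oo_LRcontinuousT dpowZ ab))
  (derivable_oo_LRcontinuousT (dpow x) ab) _
  (derivable_oo_LRcontinuous_within (derivable_oo_LRcontinuousT dexp ab))
  (derivable_oo_LRcontinuousT (fun t _ => is_derive_expRN t) ab) _.
under eq_integral do rewrite -[X in _ `^ X](addrK 1 x).
move=> ->; last 2 first.
- move=> t /[!in_itv]/= /andP[/ltW at0 _].
  by rewrite derive1E; apply: derive_val; exact: dpow.
- move=> t _; rewrite derive1E; apply: derive_val; exact: is_derive_expRN.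
congr (_ + _)%E.
under eq_integral do rewrite mulrN EFinN -mulrA EFinM.
rewrite integral_ge0N ?oppeK; last first.
  by move=> t _; rewrite mule_ge0 ?lee_fin ?gamma_integrand_ge0// ltW.
rewrite ge0_integralZl_EFin//.
- by move=> t _; rewrite lee_fin gamma_integrand_ge0.
- exact: measurable_EFin_gamma_integrand.
- exact: ltW.
Qed.

(** Both boundary terms vanish: at the upper end t^x e^(-t) <= (x + 1)^(x + 1) / t, and at the lower
    end it is at most t^x with x > 0. *)
Lemma cvg_powR_expRN x : 0 < x ->
  powR_expRN x n.+2%:R - powR_expRN x (harmonic n) @[n --> \oo] --> 0.
Proof.
move=> x0; rewrite -[X in _ --> X](subrr 0); apply: cvgB.
  have x10 : 0 < x + 1 by rewrite addr_gt0.
  rewrite -oppr0 /powR_expRN; under eq_fun do rewrite mulrN; apply: cvgN.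
  apply: (@squeeze_cvgr _ _ _ _ (fun=> 0) (fun n => (x + 1) `^ (x + 1) * harmonic n)).
  - near=> n; rewrite mulr_ge0 ?powR_ge0 ?expR_ge0//=.
    have n0 : 0 < n.+2%:R :> R by [].
    rewrite expRN ler_pdivrMr ?expR_gt0//.
    apply: (@le_trans _ _ (n.+2%:R `^ (x + 1) / n.+2%:R)).
      by rewrite -powR_inv1// -powRD ?addrK// gt_eqF// implybT.
    rewrite ler_pdivrMr//; apply: le_trans (powR_expRN_le x10 (ltW n0)) _.
    rewrite (mulrAC _ (harmonic n)) -[leRHS]mulrA.
    rewrite ler_peMr ?mulr_ge0 ?powR_ge0 ?expR_ge0//=.
    by rewrite ler_pdivlMl ?mulr1// ler_nat.
  - exact: cvg_cst.
  - rewrite -[X in _ --> X](mulr0 ((x + 1) `^ (x + 1))).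
    by apply: cvgM; [exact: cvg_cst|exact: cvg_harmonic].
have h0 : harmonic n `^ x @[n --> \oo] --> (0 : R).
  have /cvg_at_rightP := powR_cvg0 x0; apply; split; first exact: harmonic_gt0.
  exact: cvg_harmonic.
rewrite /powR_expRN; under eq_fun do rewrite mulrN; rewrite -oppr0; apply: cvgN.
apply: (@squeeze_cvgr _ _ _ _ (fun=> 0) (fun n => harmonic n `^ x)) => //.
  near=> n; rewrite mulr_ge0 ?powR_ge0 ?expR_ge0//=.
  by apply: ler_piMr; rewrite ?powR_ge0// expR_le1 oppr_le0 invr_ge0.
exact: cvg_cst.
Unshelve. all: by end_near. Qed.

(** The upper end n + 2 exceeds the lower end 1 / (n + 1) already at n = 0, since integration by
    parts needs a nondegenerate interval. *)
Lemma pos_bigcup :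
  pos = \bigcup_n `[harmonic n, n.+2%:R]%classic.
Proof.
apply/seteqP; split => t /=; rewrite in_itv/= andbT.
  move=> t0.
  have [m mP] : exists m : nat, t^-1 + t <= m%:R.
    exists (Num.bound (t^-1 + t)); apply/ltW/archi_boundP.
    by rewrite addr_ge0 ?invr_ge0 ?(ltW t0).
  exists m => //=; rewrite in_itv/=; apply/andP; split.
    rewrite -[leRHS]invrK lef_pV2 ?posrE ?invr_gt0//.
    apply: (@le_trans _ _ m%:R); last by rewrite ler_nat.
    by apply: le_trans mP; rewrite lerDl (ltW t0).
  apply: (@le_trans _ _ m%:R); last by rewrite ler_nat -addn2 leq_addr.
  by apply: le_trans mP; rewrite lerDr invr_ge0 (ltW t0).
move=> [n _ /=]; rewrite in_itv/= => /andP[+ _]; exact/lt_le_trans/harmonic_gt0.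
Qed.

Lemma cvg_gamma_integrand x :
  (\int[mu]_(t in `[harmonic n, n.+2%:R]) (gamma_integrand x t)%:E @[n --> \oo]
   --> \int[mu]_(t in pos) (gamma_integrand x t)%:E)%E.
Proof.
rewrite pos_bigcup; apply: ge0_nondecreasing_set_cvg_integral => //.
- apply/nondecreasing_seqP => n; rewrite subsetEset; apply: subset_itv; rewrite bnd_simp.
    by rewrite lef_pV2 ?posrE// ler_nat.
  by rewrite ler_nat.
- by move=> n; exact: measurable_EFin_gamma_integrand.
- by move=> n t _; rewrite lee_fin gamma_integrand_ge0.
Qed.

(** Stated in the extended reals so that [gamma_integrable] can deduce finiteness at x from
    finiteness at x + 1. *)
Lemma gamma_integral_rec x : 0 < x ->
  (\int[mu]_(t in pos) (gamma_integrand (x + 1) t)%:E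
   = x%:E * \int[mu]_(t in pos) (gamma_integrand x t)%:E)%E.
Proof.
move=> x0.
have c1 := @cvg_gamma_integrand (x + 1).
suff c2 : (\int[mu]_(t in `[harmonic n, n.+2%:R]) (gamma_integrand (x + 1) t)%:E
    @[n --> \oo] --> x%:E * \int[mu]_(t in pos) (gamma_integrand x t)%:E)%E.
  by rewrite -(cvg_lim _ c1)//; exact: cvg_lim.
rewrite -[X in _ --> X]add0e.
have -> : (fun n => \int[mu]_(t in `[harmonic n, n.+2%:R]) (gamma_integrand (x + 1) t)%:E)%E
    = (fun n => (powR_expRN x n.+2%:R - powR_expRN x (harmonic n))%:E
     + x%:E * \int[mu]_(t in `[harmonic n, n.+2%:R]) (gamma_integrand x t)%:E)%E.
  apply/funext => n; apply: gamma_integrand_parts => //; first exact: harmonic_gt0.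
  by rewrite /=; apply: (@le_lt_trans _ _ 1); rewrite ?invf_le1// ?ler1n// ltr1n.
apply: cvgeD; first by [].
  by apply: cvg_EFin; [near=> n|exact: cvg_powR_expRN].
apply: cvgeZl => //; exact: cvg_gamma_integrand.
Unshelve. all: by end_near. Qed.

Lemma gamma_integrable x : 0 < x -> mu.-integrable pos (EFin \o gamma_integrand x).
Proof.
move=> x0; apply/integrableP; split; first exact: measurable_EFin_gamma_integrand.
have -> : (\int[mu]_(t in pos) `|(EFin \o gamma_integrand x) t|
    = \int[mu]_(t in pos) (gamma_integrand x t)%:E)%E.
  by apply: eq_integral => t _ /=; rewrite ger0_norm ?gamma_integrand_ge0.
have /integrableP[_] : mu.-integrable pos (EFin \o gamma_integrand (x + 1)).
  by apply: gamma_integrable_gt1; rewrite ltrDr.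
have -> : (\int[mu]_(t in pos) `|(EFin \o gamma_integrand (x + 1)) t|
    = \int[mu]_(t in pos) (gamma_integrand (x + 1) t)%:E)%E.
  by apply: eq_integral => t _ /=; rewrite ger0_norm ?gamma_integrand_ge0.
rewrite gamma_integral_rec// !ltey; apply: contra => /eqP ->.
by rewrite gt0_muley ?lte_fin.
Qed.

Lemma GammaD1 x : 0 < x -> Gamma (x + 1) = x * Gamma x.
Proof.
move=> x0; rewrite /Gamma /Rintegral.
have := gamma_integral_rec x0; rewrite /gamma_integrand => ->.
rewrite fineM//; apply: integrable_fin_num => //; exact: gamma_integrable.
Qed.

(** Passing to x + 1 makes the power of t at least 1 on [1, 2], so the integrand there is at least
    e^(-2). *)
Lemma Gamma_gt0 x : 0 < x -> 0 < Gamma x.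
Proof.
move=> x0.
suff : 0 < Gamma (x + 1) by rewrite GammaD1// pmulr_rgt0.
have int1 : mu.-integrable pos (EFin \o gamma_integrand (x + 1)).
  by apply: gamma_integrable; rewrite addr_gt0.
have fin : (\int[mu]_(t in pos) (gamma_integrand (x + 1) t)%:E)%E \is a fin_num.
  by apply: integrable_fin_num.
rewrite -lte_fin /Gamma /Rintegral fineK//.
apply: (@lt_le_trans _ _ (\int[mu]_(t in `[1%R, 2%R]) (expR (- 2))%:E)%E).
  rewrite integral_cst//= lebesgue_measure_itv/= lte_fin ltr1n -EFinD -EFinM lte_fin.
  by rewrite mulr_gt0 ?expR_gt0//; lra.
apply: (@le_trans _ _ (\int[mu]_(t in `[1%R, 2%R]) (gamma_integrand (x + 1) t)%:E)%E).
  apply: ge0_le_integral => //.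
  - exact: measurable_EFin_gamma_integrand.
  - move=> t /=; rewrite in_itv/= => /andP[t1 t2].
    rewrite lee_fin /gamma_integrand addrK -[leLHS]mul1r ler_pM ?expR_ge0//.
      by rewrite -(powRr0 t) ler_powR// ltW.
    by rewrite ler_expR lerN2.
apply: ge0_subset_integral => //.
- exact: measurable_EFin_gamma_integrand.
- by move=> t _; rewrite lee_fin gamma_integrand_ge0.
- by move=> t /=; rewrite !in_itv/= andbT => /andP[t1 _]; apply: lt_le_trans t1.
Qed.

(* Integrate (t^a - l^a)(t^b - l^b) >= 0 with l^a = Gamma (x + a) / Gamma x. *)
Lemma Gamma_mul_le x a b : 0 < x -> 0 < a -> 0 < b ->
  Gamma (x + a) * Gamma (x + b) <= Gamma x * Gamma (x + a + b).
Proof.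
(* The final arithmetic, with k = l^b: the choice l^a = ga / g makes the terms in k cancel. *)
have key (g ga gb gab k : R) : 0 < g ->
    ga / g * gb + k * ga <= 1 * gab + ga / g * k * g -> ga * gb <= g * gab.
  move=> g0; have -> : ga / g * k * g = k * ga by field; rewrite gt_eqF.
  by rewrite lerD2r mul1r mulrAC ler_pdivrMr// [g * _]mulrC.
move=> x0 a0 b0.
have xa0 : 0 < x + a by rewrite addr_gt0.
have xb0 : 0 < x + b by rewrite addr_gt0.
have xab0 : 0 < x + a + b by rewrite addr_gt0.
have G0 := Gamma_gt0 x0; have Ga0 := Gamma_gt0 xa0.
pose l := (Gamma (x + a) / Gamma x) `^ a^-1.
have q0 := divr_gt0 Ga0 G0.
have l0 : 0 < l := powR_gt0 _ q0.
have la : l `^ a = Gamma (x + a) / Gamma x.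
  by rewrite -powRrM mulVf ?(lt0r_neq0 a0)// powRr1 ?(ltW q0).
have intG y : 0 < y -> mu.-integrable pos (EFin \o gamma_integrand y).
  exact: gamma_integrable.
have intZ r y : 0 < y -> mu.-integrable pos (EFin \o (fun t => r * gamma_integrand y t)).
  move=> y0; have -> : EFin \o (fun t => r * gamma_integrand y t)
    = (fun t => r%:E * (EFin \o gamma_integrand y) t)%E by [].
  by apply: integrableZl => //; exact: intG.
have intZ2 r s y z : 0 < y -> 0 < z -> mu.-integrable pos
    (EFin \o (fun t => r * gamma_integrand y t + s * gamma_integrand z t)).
  move=> y0 z0; exact: (integrableD _ (intZ r y y0) (intZ s z z0)).
have intE r s y z : 0 < y -> 0 < z ->
    \int[mu]_(t in pos) (r * gamma_integrand y t + s * gamma_integrand z t)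
    = r * Gamma y + s * Gamma z.
  move=> y0 z0; rewrite RintegralD//; [|exact: intZ|exact: intZ].
  by rewrite !RintegralZl//; exact: intG.
have : l `^ a * Gamma (x + b) + l `^ b * Gamma (x + a)
    <= 1 * Gamma (x + a + b) + l `^ a * l `^ b * Gamma x.
  rewrite -(intE _ _ _ _ xb0 xa0) -(intE _ _ _ _ xab0 x0).
  apply: le_Rintegral => //; [exact: intZ2|exact: intZ2|].
  move=> t /=; rewrite in_itv/= andbT => t0.
  have gD y : gamma_integrand (x + y) t = t `^ y * gamma_integrand x t.
    by rewrite /gamma_integrand mulrA -powRD ?(gt_eqF t0) ?implybT// addrAC addrC.
  rewrite -addrA !gD powRD ?(gt_eqF t0) ?implybT//.
  rewrite -subr_ge0.
  have -> : 1 * (t `^ a * t `^ b * gamma_integrand x t) + l `^ a * l `^ b * gamma_integrand x t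
    - (l `^ a * (t `^ b * gamma_integrand x t) + l `^ b * (t `^ a * gamma_integrand x t))
    = (t `^ a - l `^ a) * (t `^ b - l `^ b) * gamma_integrand x t by ring.
  rewrite mulr_ge0 ?gamma_integrand_ge0//.
  have mono y : 0 < y -> (l <= t -> l `^ y <= t `^ y) /\ (t <= l -> t `^ y <= l `^ y).
    by move=> y0; split => ?;
      apply: ge0_ler_powR; rewrite ?nnegrE ?(ltW y0) ?(ltW t0) ?(ltW l0).
  have [ma1 ma2] := mono a a0; have [mb1 mb2] := mono b b0.
  have [/[dup] /ma1 h1 /mb1 h2|/ltW /[dup] /ma2 h1 /mb2 h2] := leP l t.
    by rewrite mulr_ge0 ?subr_ge0.
  by rewrite mulr_le0 ?subr_le0.
rewrite la => h; exact: key G0 h.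
Qed.

End GammaFunction.

(** * Gauss's sum at 1 and the Gamma quotient *)

Section GaussGamma.
Variable R : realType.
Implicit Types a b c : R.

(** For k >= 1, (c + N)_k is at least (c + N) / c times (c)_k, by its first factor alone; so every
    term but the constant one shrinks at least by c / (c + N). *)
Lemma gauss_sum_shift_le a b c N : 0 < a -> 0 < b -> a + b < c ->
  gauss_sum a b (c + N%:R) <= 1 + c / (c + N%:R) * gauss_sum a b c.
Proof.
move=> a0 b0 abc; have c0 : 0 < c by lra.
have N0 : 0 <= N%:R :> R by [].
have cN0 : 0 < c + N%:R by lra.
have cg := is_cvg_gauss a0 b0 abc.
have cgN : cvgn (series (gauss_term a b (c + N%:R))) by apply: is_cvg_gauss => //; lra.
have poch k : pochhammer (c + N%:R) k.+1 >= (c + N%:R) / c * pochhammer c k.+1.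
  elim: k => [|k ih].
    by rewrite !pochhammerS !pochhammer0 !mul1r !addr0 divfK// gt_eqF.
  rewrite pochhammerS [leRHS]pochhammerS mulrA.
  apply: ler_pM => //; last by rewrite lerD2r lerDl.
    by rewrite mulr_ge0 ?divr_ge0 ?(ltW cN0) ?(ltW c0)// ltW// pochhammer_gt0.
  by rewrite addr_ge0 ?(ltW c0).
have termle k : gauss_term a b (c + N%:R) k
    <= (k == 0)%:R + c / (c + N%:R) * gauss_term a b c k.
  case: k => [|k].
    rewrite /gauss_term !pochhammer0 fact0 !mulr1 !divr1 mulr1 eqxx.
    by rewrite lerDl divr_ge0 ?(ltW cN0) ?(ltW c0).
  rewrite add0r /gauss_term mulrCA ler_pM2l ?mulr_gt0 ?pochhammer_gt0//.
  rewrite !invfM mulrA ler_pM2r ?invr_gt0 ?ltr0n ?fact_gt0//.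
  rewrite -[c / _]invf_div -invfM lef_pV2 ?posrE ?(mulr_gt0 (divr_gt0 cN0 c0)) ?pochhammer_gt0//.
have le_partial n : series (gauss_term a b (c + N%:R)) n
    <= 1 + c / (c + N%:R) * series (gauss_term a b c) n.
  case: n => [|n].
    by rewrite /series/= !big_geq// mulr0 addr0.
  rewrite !seriesEord /= big_distrr /=.
  apply: (@le_trans _ _ (\sum_(i < n.+1)
    ((i == 0%N :> nat)%:R + c / (c + N%:R) * gauss_term a b c i))).
    by apply: ler_sum => i _; exact: termle.
  rewrite big_split /= lerD2r big_ord_recl /= big1 ?addr0// => i _.
rewrite /gauss_sum; apply: limr_le => //; near=> n.
apply: le_trans (le_partial n) _; rewrite lerD2l ler_pM2l ?divr_gt0//.
apply: nondecreasing_cvgn_le => //; apply: nondecreasing_series => i _ _.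
exact/ltW/gauss_term_gt0.
Unshelve. all: by end_near. Qed.

(* Half of Gauss's summation theorem.  The quotient of the two sides is invariant
   under c |-> c + 1, and gauss_sum a b (c + N) tends to 1. *)
Lemma gauss_sum_le_Gamma a b c : 0 < a -> 0 < b -> a + b < c ->
  gauss_sum a b c
  <= Gamma c * Gamma (c - a - b) / (Gamma (c - a) * Gamma (c - b)).
Proof.
move=> a0 b0 abc; have c0 : 0 < c by lra.
pose K x := Gamma x * Gamma (x - a - b).
pose M x := Gamma (x - a) * Gamma (x - b).
have GD1 x y : 0 < x - y -> Gamma (x + 1 - y) = (x - y) * Gamma (x - y).
  by move=> xy; rewrite addrAC GammaD1.
have K0 x : a + b < x -> 0 < K x by move=> ?; apply: mulr_gt0; apply: Gamma_gt0; lra.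
have M0 x : a + b < x -> 0 < M x by move=> ?; apply: mulr_gt0; apply: Gamma_gt0; lra.
(* Log-convexity of Gamma, with base point x - a - b. *)
have MK x : a + b < x -> M x <= K x.
  move=> abx; have x0 : 0 < x - a - b by lra.
  have := Gamma_mul_le x0 b0 a0.
  have -> : x - a - b + b = x - a by ring.
  have -> : x - a - b + a = x - b by ring.
  by rewrite subrK [Gamma (x - a - b) * _]mulrC.
have KS x : a + b < x -> K (x + 1) = x * (x - a - b) * K x.
  move=> abx; rewrite /K GammaD1; last lra.
  have -> : x + 1 - a - b = x - a - b + 1 by ring.
  by rewrite GammaD1; [rewrite mulrACA|lra].
have MS x : a + b < x -> M (x + 1) = (x - a) * (x - b) * M x.
  by move=> abx; rewrite /M !GD1; [rewrite mulrACA|lra|lra].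
rewrite -[leRHS]/(K c / M c).
(* The two Gamma products are now abstracted to their recurrences, their positivity and M <= K. *)
move: K M K0 M0 MK KS MS {GD1} => K M K0 M0 MK KS MS.
pose rho x := gauss_sum a b x * M x / K x.
have rhoS x : a + b < x -> rho (x + 1) = rho x.
  move=> abx; have := gauss_sum_contiguous_c a0 b0 abx.
  rewrite /rho KS// MS// => h.
  have x1 : x * (x - a - b) != 0 by rewrite mulf_neq0// gt_eqF//; lra.
  have -> : gauss_sum a b x = (x - a) * (x - b) * gauss_sum a b (x + 1) / (x * (x - a - b)).
    by rewrite -h mulrC mulKf.
  field; rewrite !gt_eqF ?K0//; lra.
have rhoD N : rho (c + N%:R) = rho c.
  elim: N => [|N ih]; first by rewrite addr0.
  have N0 : 0 <= N%:R :> R by [].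
  by rewrite -natr1 addrA rhoS//; lra.
have rho_le N : rho c <= 1 + c / (c + N%:R) * gauss_sum a b c.
  have N0 : 0 <= N%:R :> R by [].
  have abN : a + b < c + N%:R by lra.
  rewrite -(rhoD N); apply: le_trans (gauss_sum_shift_le N a0 b0 abc).
  rewrite /rho -mulrA ler_piMr//; last by rewrite ler_pdivrMr ?K0// mul1r MK.
  apply: limr_ge; first exact: is_cvg_gauss.
  near=> n; rewrite /series /= sumr_ge0// => i _.
  by rewrite ltW// gauss_term_gt0//; lra.
suff rho1 : rho c <= 1.
  rewrite ler_pdivlMr ?M0//.
  by move: rho1; rewrite /rho ler_pdivrMr ?K0// mul1r.
rewrite leNgt; apply/negP => rho1.
pose e := rho c - 1; have e0 : 0 < e by rewrite /e subr_gt0.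
(* For N beyond B, c / (c + N) times the sum falls below e, contradicting [rho_le]. *)
pose B := c * gauss_sum a b c / e.
have H0 : 0 <= gauss_sum a b c.
  apply: limr_ge; first exact: is_cvg_gauss.
  near=> n; rewrite /series /= sumr_ge0// => i _.
  by rewrite ltW// gauss_term_gt0.
have B0 : 0 <= B by rewrite /B !mulr_ge0 ?invr_ge0 ?(ltW e0) ?(ltW c0).
have [N NP] : exists N : nat, B < N%:R.
  by exists (Num.bound B); exact: archi_boundP.
have := rho_le N; rewrite addrC -lerBlDr -/e mulrAC ler_pdivlMr; last lra.
rewrite leNgt => /negP; apply.
rewrite -ltr_pdivrMl// mulrC -/B; lra.
Unshelve. all: by end_near. Qed.

End GaussGamma.

(** * Complex power series *)

Section ComplexModulus.
Variable R : realType.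
Implicit Types z w : Cx R.

Lemma normCxE z : `|z| = (cabs z)%:C%C.
Proof. by rewrite /cabs normc_def. Qed.

Lemma cabsE z : cabs z = Num.sqrt (complex.Re z ^+ 2 + complex.Im z ^+ 2).
Proof. by rewrite /cabs normc_def. Qed.

Lemma cabs_ge0 z : 0 <= cabs z.
Proof. by rewrite cabsE sqrtr_ge0. Qed.

Lemma cabsM z w : cabs (z * w) = cabs z * cabs w.
Proof. by rewrite /cabs normrM !normCxE -rmorphM. Qed.

Lemma cabsD z w : cabs (z + w) <= cabs z + cabs w.
Proof. by rewrite -lecR rmorphD /= -!normCxE ler_normD. Qed.

Lemma cabsN z : cabs (- z) = cabs z.
Proof. by rewrite /cabs normrN. Qed.

Lemma cabsB z w : cabs (z - w) <= cabs z + cabs w.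
Proof. by rewrite -(cabsN w) cabsD. Qed.

Lemma cabs_real (x : R) : cabs x%:C%C = `|x|.
Proof. by rewrite cabsE /= expr0n addr0 sqrtr_sqr. Qed.

Lemma cabs0 : cabs (0 : Cx R) = 0.
Proof. by rewrite /cabs normr0. Qed.

Lemma cabs1 : cabs (1 : Cx R) = 1.
Proof. by rewrite /cabs normr1. Qed.

Lemma cabs_nat n : cabs (n%:R : Cx R) = n%:R.
Proof. by rewrite /cabs normr_nat -[n%:R]/(n%:R : R[i]) -(rmorph_nat (real_complex R)). Qed.

Lemma cabsX z n : cabs (z ^+ n) = cabs z ^+ n.
Proof. by elim: n => [|n ih]; rewrite ?expr0 ?cabs1// !exprS cabsM ih. Qed.

Lemma cabs_eq0 z : (cabs z == 0) = (z == 0).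
Proof. by rewrite -[in RHS]normr_eq0 normCxE -(inj_eq (@complexI R)). Qed.

Lemma cabs_gt0 z : (0 < cabs z) = (z != 0).
Proof. by rewrite lt0r cabs_eq0 cabs_ge0 andbT. Qed.

Lemma cabsV z : cabs z^-1 = (cabs z)^-1.
Proof. by rewrite /cabs normfV normCxE -fmorphV. Qed.

Lemma cabs_sum (I : Type) (r : seq I) (P : pred I) (F : I -> Cx R) :
  cabs (\sum_(i <- r | P i) F i) <= \sum_(i <- r | P i) cabs (F i).
Proof.
elim/big_ind2: _ => [|x1 y1 x2 y2 h1 h2|//]; first by rewrite cabs0.
by apply: le_trans (cabsD _ _) _; exact: lerD.
Qed.

Lemma Re_le_cabs z : `|complex.Re z| <= cabs z.
Proof. by rewrite -lecR -normCxE normc_ge_Re. Qed.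

Lemma ReB z w : complex.Re (z - w) = complex.Re z - complex.Re w.
Proof. by case: z w => [? ?] [? ?]. Qed.

Lemma ReD z w : complex.Re (z + w) = complex.Re z + complex.Re w.
Proof. by case: z w => [? ?] [? ?]. Qed.

Lemma ImB z w : complex.Im (z - w) = complex.Im z - complex.Im w.
Proof. by case: z w => [? ?] [? ?]. Qed.

Lemma ImD z w : complex.Im (z + w) = complex.Im z + complex.Im w.
Proof. by case: z w => [? ?] [? ?]. Qed.

Lemma Im_le_cabs z : `|complex.Im z| <= cabs z.
Proof.
by rewrite cabsE -sqrtr_sqr ler_wsqrtr// lerDr sqr_ge0.
Qed.

Lemma cabs_le_ReIm z : cabs z <= `|complex.Re z| + `|complex.Im z|.
Proof.
have -> : `|complex.Re z| + `|complex.Im z|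
    = Num.sqrt ((`|complex.Re z| + `|complex.Im z|) ^+ 2).
  by rewrite sqrtr_sqr [RHS]ger0_norm// addr_ge0.
rewrite cabsE ler_wsqrtr//.
rewrite -(real_normK (num_real (complex.Re z))) -(real_normK (num_real (complex.Im z))).
by rewrite sqrrD addrAC lerDl mulrn_wge0 ?mulr_ge0.
Qed.

Lemma gt0_CxE (e : Cx R) : 0 < e -> e = (complex.Re e)%:C%C /\ 0 < complex.Re e.
Proof. by case: e => x y; rewrite ltcE /= => /andP[/eqP -> ->]. Qed.

Lemma cvg_CxP (T : Type) (F : set_system T) (FF : Filter F) (f : T -> Cx R) (l : Cx R) :
  f @ F --> l <-> forall e : R, 0 < e -> \forall t \near F, cabs (f t - l) < e.
Proof.
split=> [/cvgrPdist_lt fl e e0|fl].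
  have /fl : (0 : Cx R) < e%:C%C by rewrite ltcR.
  by apply: filterS => t; rewrite distrC normCxE ltcR.
apply/cvgrPdist_lt => e /gt0_CxE[-> /fl].
by apply: filterS => t; rewrite distrC normCxE ltcR.
Qed.

Lemma cvg_cabs (u : nat -> Cx R) (l : Cx R) : u @ \oo --> l ->
  (fun n => cabs (u n)) @ \oo --> cabs l.
Proof.
move=> /cvg_CxP ul; apply/cvgrPdist_lt => e /ul; apply: filterS => n.
apply: le_lt_trans; rewrite ler_norml; apply/andP; split.
  by rewrite lerNl opprB lerBlDr (le_trans _ (cabsD _ _))// subrK.
rewrite lerBlDr -(cabsN (u n - l)) (le_trans _ (cabsD _ _))//.
by rewrite opprB subrK.
Qed.

Lemma cvg_Re (u : nat -> Cx R) (l : Cx R) : u @ \oo --> l ->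
  (fun n => complex.Re (u n)) @ \oo --> complex.Re l.
Proof.
move=> /cvg_CxP ul; apply/cvgrPdist_lt => e /ul; apply: filterS => n.
by apply: le_lt_trans; rewrite distrC -ReB Re_le_cabs.
Qed.

Lemma Re_series (u : nat -> Cx R) n :
  complex.Re (series u n) = series (fun k => complex.Re (u k)) n.
Proof.
elim: n => [|n ih]; first by rewrite /series/= !big_geq.
by rewrite !seriesSr ReD ih.
Qed.

Lemma Im_series (u : nat -> Cx R) n :
  complex.Im (series u n) = series (fun k => complex.Im (u k)) n.
Proof.
elim: n => [|n ih]; first by rewrite /series/= !big_geq.
by rewrite !seriesSr ImD ih.
Qed.

Lemma cabs_is_cvg_series (u : nat -> Cx R) :
  cvgn (series (fun n => cabs (u n))) -> cvgn (series u).
Proof.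
move=> cu.
have cR : cvgn (series (fun k => complex.Re (u k))).
  by apply: dominated_series cu => n; exact: Re_le_cabs.
have cI : cvgn (series (fun k => complex.Im (u k))).
  by apply: dominated_series cu => n; exact: Im_le_cabs.
apply/cvg_ex; exists (limn (series (fun k => complex.Re (u k)))
  +i* limn (series (fun k => complex.Im (u k))))%C.
apply/cvg_CxP => e e0.
have e20 : 0 < e / 2 by rewrite divr_gt0.
move/cvgrPdist_lt : cR => /(_ _ e20) h1; move/cvgrPdist_lt : cI => /(_ _ e20) h2.
near=> n; apply: le_lt_trans (cabs_le_ReIm _) _.
rewrite ReB ImB Re_series Im_series /= (splitr e).
apply: ltrD; rewrite distrC; near: n; [exact: h1|exact: h2].
Unshelve. all: by end_near. Qed.

End ComplexModulus.

(** * Termwise differentiation of power series *)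

Section PowerSeries.
Variable R : realType.
Implicit Types (u : nat -> Cx R) (z w : Cx R) (f g : Cx R -> Cx R).

(** The coefficients of (1 - t)^(-3) are (n + 1)(n + 2) / 2, and twice them dominates n^2. *)
Lemma is_cvg_sqr_geometric (x : R) : 0 <= x < 1 ->
  cvgn (series (fun n => n%:R ^+ 2 * x ^+ n)).
Proof.
move=> x01; have x0 : 0 <= x by case/andP: x01.
have p3 : 0 < 3 :> R by [].
have c := is_cvg_seriesM (e := 2) (is_cvg_binom p3 x01).
apply: (dominated_series _ c) => n /=.
rewrite ger0_norm ?mulr_ge0 ?exprn_ge0// mulrA ler_wpM2r ?exprn_ge0//.
suff -> : binom_coef (3 : R) n = (n%:R + 1) * (n%:R + 2) / 2.
  by have n0 : 0 <= n%:R :> R := ler0n _ _; nra.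
elim: n => [|n ih]; first by rewrite binom_coef0; field.
have n1 : n%:R + 1 != 0 :> R by rewrite gt_eqF// natr1_gt0.
by apply: (mulfI n1); rewrite binom_coefS ih -natr1; field.
Qed.

(** The terms are bounded at a radius s between rho and r, which leaves the ratio (rho / s)^n. The
    weight n^2 serves the second-order remainder in [pseries_is_derive]. *)
Lemma pseries_abs_cvg u z0 r f (rho : R) :
  pseries_on u z0 r f -> 0 < r -> 0 <= rho -> rho < complex.Re r ->
  cvgn (series (fun n => n%:R ^+ 2 * (cabs (u n) * rho ^+ n))).
Proof.
move=> uf r0 rho0 rhor; have [rE rr0] := gt0_CxE r0.
pose s := (rho + complex.Re r) / 2.
have rhos : rho < s by rewrite /s; lra.
have sr : s < complex.Re r by rewrite /s; lra.
have s0 : 0 < s := le_lt_trans rho0 rhos.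
have : `|z0 + s%:C%C - z0| < r.
  by rewrite addrC addKr normCxE cabs_real rE ltcR gtr0_norm.
move/uf; rewrite addrC addKr => us.
have /cvg_series_cvg_0 : cvgn (series (fun n => u n * s%:C%C ^+ n)) by exact: cvgP us.
move/cvg_cabs; rewrite cabs0 => /(cvgP _) /cvg_seq_bounded/bounded_fun_has_ubound[M MP].
have x01 : 0 <= rho / s < 1 by rewrite divr_ge0 ?(ltW s0)//= ltr_pdivrMr ?mul1r.
have c := is_cvg_seriesM (e := M) (is_cvg_sqr_geometric x01).
apply: (dominated_series _ c) => n /=.
rewrite ger0_norm ?mulr_ge0 ?exprn_ge0 ?cabs_ge0// [leRHS]mulrCA ler_wpM2l ?exprn_ge0//.
have -> : rho ^+ n = s ^+ n * (rho / s) ^+ n.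
  by rewrite -exprMn mulrC divfK// gt_eqF.
rewrite mulrA ler_wpM2r ?exprn_ge0//; first by case/andP: x01.
have := MP (cabs (u n * s%:C%C ^+ n)).
by rewrite cabsM cabsX cabs_real (gtr0_norm s0); apply; exists n => //; rewrite cabsM cabsX cabs_real (gtr0_norm s0).
Qed.

Lemma expr_taylor1 (z w : Cx R) n :
  w ^+ n.+1 - z ^+ n.+1 - n.+1%:R * z ^+ n * (w - z)
  = w * (w ^+ n - z ^+ n - n%:R * z ^+ n.-1 * (w - z))
    + n%:R * z ^+ n.-1 * (w - z) ^+ 2.
Proof.
case: n => [|n]; first by rewrite !expr0 !expr1; ring.
by rewrite /= !exprS -!natr1; ring.
Qed.

(** Induction through [expr_taylor1], closed by n^2 + n <= (n + 1)^2. The factor rho^2 on the left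
    avoids the exponent n - 2, which would truncate for n < 2. *)
Lemma expr_taylor1_le (z w : Cx R) (rho : R) n : cabs z <= rho -> cabs w <= rho ->
  cabs (w ^+ n - z ^+ n - n%:R * z ^+ n.-1 * (w - z)) * rho ^+ 2
  <= n%:R ^+ 2 * rho ^+ n * cabs (w - z) ^+ 2.
Proof.
move=> zr wr; have r0 : 0 <= rho := le_trans (cabs_ge0 z) zr.
elim: n => [|n ih]; first
  by rewrite !expr0 !mul0r subrr subr0 cabs0 mul0r !mulr_ge0 ?exprn_ge0 ?cabs_ge0.
rewrite expr_taylor1.
set E := cabs _ in ih; set d := cabs (w - z) in ih *.
have d0 : 0 <= d := cabs_ge0 _.
have h1 : cabs (w * (w ^+ n - z ^+ n - n%:R * z ^+ n.-1 * (w - z))) * rho ^+ 2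
    <= rho * (n%:R ^+ 2 * rho ^+ n * d ^+ 2).
  rewrite cabsM -/E -mulrA; apply: ler_pM => //; first exact: cabs_ge0.
  by rewrite mulr_ge0 ?cabs_ge0 ?exprn_ge0.
have h2 : cabs (n%:R * z ^+ n.-1 * (w - z) ^+ 2) * rho ^+ 2
    <= n%:R * rho ^+ n.+1 * d ^+ 2.
  case: n {ih E h1} => [|n]; first by rewrite !mul0r cabs0 mul0r.
  rewrite !cabsM !cabsX cabs_nat -/d mulrAC ler_wpM2r ?sqr_ge0//.
  have -> : rho ^+ n.+2 = rho ^+ n * rho ^+ 2 by rewrite -exprD addn2.
  rewrite -mulrA ler_wpM2l//= ler_wpM2r ?exprn_ge0//.
  by rewrite lerXn2r ?nnegrE ?cabs_ge0.
apply: (@le_trans _ _ (rho * (n%:R ^+ 2 * rho ^+ n * d ^+ 2) + n%:R * rho ^+ n.+1 * d ^+ 2)).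
  apply: le_trans (lerD h1 h2); rewrite -mulrDl ler_wpM2r ?exprn_ge0//.
  by rewrite cabsD.
have -> : rho * (n%:R ^+ 2 * rho ^+ n * d ^+ 2) + n%:R * rho ^+ n.+1 * d ^+ 2
  = (n%:R ^+ 2 + n%:R) * (rho ^+ n.+1 * d ^+ 2) by rewrite (exprS rho n); ring.
rewrite -[leRHS]mulrA ler_wpM2r ?mulr_ge0 ?exprn_ge0 ?cabs_ge0//.
by rewrite -natr1; have : 0 <= n%:R :> R := ler0n _ _; nra.
Qed.

Definition pderiv u (n : nat) : Cx R := n.+1%:R * u n.+1.

Lemma pseries_pderiv_cvg u z0 r f z :
  pseries_on u z0 r f -> 0 < r -> `|z - z0| < r ->
  cvgn (series (fun n => pderiv u n * (z - z0) ^+ n)).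
Proof.
move=> uf r0 zr; have [rE rr0] := gt0_CxE r0.
have zr' : cabs (z - z0) < complex.Re r by move: zr; rewrite normCxE {1}rE ltcR.
pose rho := (cabs (z - z0) + complex.Re r) / 2.
have zrho : cabs (z - z0) < rho by rewrite /rho; lra.
have rho0 : 0 < rho := le_lt_trans (cabs_ge0 _) zrho.
have c := pseries_abs_cvg uf r0 (ltW rho0) (ltac:(rewrite /rho; lra) : rho < complex.Re r).
apply: cabs_is_cvg_series.
have c' : cvgn (series (fun n => rho^-1 * (n.+1%:R ^+ 2 * (cabs (u n.+1) * rho ^+ n.+1)))).
  apply: is_cvg_seriesM.
  have -> : series (fun n => n.+1%:R ^+ 2 * (cabs (u n.+1) * rho ^+ n.+1))
    = (fun N => series (fun n => n%:R ^+ 2 * (cabs (u n) * rho ^+ n)) (N + 1)%N).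
    apply/funext => N; rewrite addn1 /series /= big_nat_recl//= expr0n mul0r add0r.
    by [].
  by apply: (cvgP (limn (series (fun n => n%:R ^+ 2 * (cabs (u n) * rho ^+ n))))); rewrite cvg_shiftn.
apply: (dominated_series _ c') => n /=.
rewrite ger0_norm ?cabs_ge0// /pderiv !cabsM cabs_nat cabsX (exprS rho).
have -> : rho^-1 * (n.+1%:R ^+ 2 * (cabs (u n.+1) * (rho * rho ^+ n)))
  = n.+1%:R ^+ 2 * cabs (u n.+1) * rho ^+ n by field; rewrite gt_eqF.
apply: ler_pM; rewrite ?mulr_ge0 ?exprn_ge0 ?cabs_ge0//.
  by rewrite ler_wpM2r ?cabs_ge0// expr2 ler_peMl// ler1n.
by rewrite lerXn2r ?nnegrE ?cabs_ge0 ?ltW.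
Qed.

(** Summing the remainders of the powers bounds f (z + h) - f z - h G by K |h|^2 / rho^2, where K is
    the sum weighted by n^2. *)
Lemma pseries_is_derive u z0 r f z :
  pseries_on u z0 r f -> 0 < r -> `|z - z0| < r ->
  is_derive z 1 f (limn (series (fun n => pderiv u n * (z - z0) ^+ n))).
Proof.
move=> uf r0 zr; have [rE rr0] := gt0_CxE r0.
have zr' : cabs (z - z0) < complex.Re r by move: zr; rewrite normCxE {1}rE ltcR.
set G := limn _.
have cG := pseries_pderiv_cvg uf r0 zr.
pose rho := (cabs (z - z0) + complex.Re r) / 2.
have zrho : cabs (z - z0) < rho by rewrite /rho; lra.
have rhor : rho < complex.Re r by rewrite /rho; lra.
have rho0 : 0 < rho := le_lt_trans (cabs_ge0 _) zrho.
have c := pseries_abs_cvg uf r0 (ltW rho0) rhor.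
pose K := limn (series (fun n => n%:R ^+ 2 * (cabs (u n) * rho ^+ n))).
have K_ge N : series (fun n => n%:R ^+ 2 * (cabs (u n) * rho ^+ n)) N <= K.
  apply: nondecreasing_cvgn_le => //; apply: nondecreasing_series => i _ _.
  by rewrite !mulr_ge0 ?exprn_ge0 ?cabs_ge0 ?(ltW rho0).
have K0 : 0 <= K by apply: le_trans (K_ge 0%N); rewrite /series/= big_geq.
have main h : cabs (z + h - z0) <= rho ->
    cabs (f (z + h) - f z - h * G) * rho ^+ 2 <= K * cabs h ^+ 2.
  move=> hrho.
  have hr : `|z + h - z0| < r by rewrite normCxE {1}rE ltcR (le_lt_trans hrho).
  pose a := z - z0; pose w := z + h - z0.
  have wa : w - a = h by rewrite /w /a; ring.
  (* The derivative series stops one index earlier because [pderiv] lowers degrees by one; the three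
     partial sums then combine degree by degree. *)
  have cE : (fun N => series (fun n => u n * w ^+ n) N.+1 - series (fun n => u n * a ^+ n) N.+1
      - h * series (fun n => pderiv u n * a ^+ n) N) @ \oo --> f (z + h) - f z - h * G.
    apply: cvgB; last by apply: cvgM; [exact: cvg_cst|exact: cG].
    apply: cvgB.
      have := uf _ hr; rewrite -(cvg_shiftn 1).
      by under eq_fun do rewrite addn1.
    have := uf _ zr; rewrite -(cvg_shiftn 1).
    by under eq_fun do rewrite addn1.
  have EE N : series (fun n => u n * w ^+ n) N.+1 - series (fun n => u n * a ^+ n) N.+1
      - h * series (fun n => pderiv u n * a ^+ n) N
    = series (fun n => u n * (w ^+ n - a ^+ n - n%:R * a ^+ n.-1 * (w - a))) N.+1.
    have -> : h * series (fun n => pderiv u n * a ^+ n) N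
      = series (fun n => u n * (n%:R * a ^+ n.-1 * (w - a))) N.+1.
      rewrite /series /= [in RHS]big_nat_recl//= !mul0r mulr0 add0r big_distrr.
      by apply: eq_bigr => i _; rewrite wa /pderiv /=; ring.
    rewrite /series /= -!sumrB; apply: eq_bigr => i _; ring.
  have := cvg_cabs cE => cE'.
  rewrite -ler_pdivlMr ?exprn_gt0//.
  apply: (ler_cvg_to cE' (cvg_cst _)); near=> N.
  rewrite EE ler_pdivlMr ?exprn_gt0//.
  apply: (@le_trans _ _ (series (fun n => n%:R ^+ 2 * (cabs (u n) * rho ^+ n)) N.+1 * cabs h ^+ 2));
    last by rewrite ler_wpM2r ?exprn_ge0 ?cabs_ge0.
  apply: (le_trans (ler_wpM2r _ (cabs_sum _ _ _))); first by rewrite exprn_ge0 ?(ltW rho0).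
  rewrite /series /= !big_distrl /=; apply: ler_sum => i _.
  rewrite cabsM -wa.
  rewrite -[leLHS]mulrA.
  apply: le_trans (ler_wpM2l (cabs_ge0 _) (expr_taylor1_le i (ltW zrho) hrho)) _.
  by rewrite le_eqVlt; apply/orP; left; apply/eqP; ring.
have cvgD : (fun h => h^-1 *: ((f \o shift z) (h *: 1) - f z)) @ 0^' --> G.
  apply/cvg_CxP => e e0.
  (* The first bound keeps z + h within rho of z0, the second makes K |h| / rho^2 < e; K + 1 is
     positive even if K = 0. *)
  pose d := Num.min (rho - cabs (z - z0)) (e * rho ^+ 2 / (K + 1)).
  have K10 : 0 < K + 1 by rewrite ltr_wpDl.
  have d0 : 0 < d.
    by rewrite lt_min subr_gt0 zrho !(mulr_gt0 e0, divr_gt0) ?exprn_gt0.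
  have : \forall h \near (0 : Cx R)^', h != 0 /\ cabs h < d.
    exists d%:C%C; first by rewrite /= ltcR.
    move=> h /=; rewrite sub0r normrN normCxE ltcR => hd h0; split=> //.
  apply: filterS => h [h0 hd].
  have hrho : cabs (z + h - z0) <= rho.
    have -> : z + h - z0 = (z - z0) + h by ring.
    apply: le_trans (cabsD _ _) _.
    by move: hd; rewrite lt_min => /andP[/ltW + _]; rewrite lerBrDl.
  have hK : cabs h * (K + 1) < e * rho ^+ 2.
    by move: hd; rewrite lt_min => /andP[_]; rewrite ltr_pdivlMr.
  have ch0 : 0 < cabs h by rewrite cabs_gt0.
  have -> : h^-1 *: ((f \o shift z) (h *: 1) - f z) - G = h^-1 * (f (z + h) - f z - h * G).
    by rewrite /= scaler1 [_ + z]addrC [in RHS]mulrBr mulKf.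
  rewrite cabsM cabsV -(ltr_pM2r (exprn_gt0 2 rho0)) -mulrA.
  rewrite ltr_pdivrMl//; apply: le_lt_trans (main h hrho) _.
  rewrite expr2 mulrA mulrC ltr_pM2l//; apply: le_lt_trans hK.
  by rewrite mulrC ler_wpM2l ?cabs_ge0// lerDl.
apply: DeriveDef; first exact: cvgP cvgD.
exact: cvg_lim cvgD.
Unshelve. all: by end_near. Qed.

Lemma pseries_derive1 u z0 r f :
  pseries_on u z0 r f -> 0 < r -> pseries_on (pderiv u) z0 r f^`()%classic.
Proof.
move=> uf r0 z zr; rewrite derive1E.
rewrite (derive_val (is_derive := pseries_is_derive uf r0 zr)).
exact: pseries_pderiv_cvg uf r0 zr.
Qed.

Lemma pseries_cvg_center u z0 r f : pseries_on u z0 r f -> 0 < r ->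
  f @ z0 --> f z0.
Proof.
move=> uf r0; apply: differentiable_continuous; apply/derivable1_diffP.
apply: (ex_derive (is_derive := pseries_is_derive uf r0 _)).
by rewrite subrr normr0.
Qed.

Lemma pseries_at_center u z0 r f : pseries_on u z0 r f -> 0 < r -> f z0 = u 0%N.
Proof.
move=> uf r0; have := uf z0; rewrite subrr normr0 => /(_ r0) h.
apply: (cvg_unique (@norm_hausdorff _ _) h); apply: cvg_near_cst.
near=> n; have n0 : (0 < n)%N by near: n; exact: nbhs_infty_ge.
rewrite /series /= -(prednK n0) big_nat_recl//= expr0 mulr1 big1 ?addr0// => i _.
by rewrite expr0n mulr0.
Unshelve. all: by end_near. Qed.

(** The n-th derivative at 0 is the constant coefficient of the n-fold formal derivative, that is n!
    times [u n]. *)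
Lemma taylor_coef_pseries u r f n : pseries_on u 0 r f -> 0 < r ->
  taylor_coef f n = u n.
Proof.
move=> uf r0.
have fE : pseries_on (iter n pderiv u) 0 r f^`(n)%classic.
  by elim: n => [|n ih]; [rewrite derive1n0|rewrite derive1nS; exact: pseries_derive1].
rewrite /taylor_coef (pseries_at_center fE r0).
have iterE m k : iter m pderiv u k = (k + m)`!%:R / k`!%:R * u (k + m)%N.
  elim: m k => [|m ih] k.
    by rewrite addn0 divff ?mul1r// pnatr_eq0 -lt0n fact_gt0.
  have f0 : k`!%:R != 0 :> Cx R by rewrite pnatr_eq0 -lt0n fact_gt0.
  have k0 : k.+1%:R != 0 :> Cx R by rewrite pnatr_eq0.
  rewrite iterS /pderiv ih addSnnS [k.+1`!]factS natrM.
  move: (k.+1%:R) k0 => x x0; field.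
  by rewrite x0 f0.
rewrite iterE add0n fact0 divr1 mulrC mulKf// pnatr_eq0 -lt0n fact_gt0//.
Qed.

End PowerSeries.

(** * Coefficients of functions with positive real part *)

Section Caratheodory.
Variable R : realType.

(** A 2^k-th root of -1 has order dividing 2^(k+1) but not 2^k. *)
Lemma exists_prim_root_pow2 (F : numClosedFieldType) k :
  exists w : F, (2 ^ k.+1).-primitive_root w.
Proof.
have z2 : ((2 ^ k).-root (-1 : F)) ^+ (2 ^ k) = -1 by rewrite rootCK// expn_gt0.
move: (_.-root _) z2 => z z2; exists z.
have zN : z ^+ (2 ^ k.+1) = 1 by rewrite expnSr exprM z2 sqrrN expr1n.
have N0 : (0 < 2 ^ k.+1)%N by rewrite expn_gt0.
have [m zm] := prim_order_exists N0 zN.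
move/dvdn_pfactor => /(_ isT)[j jk mE].
suff -> : k.+1 = j by rewrite -mE.
apply/eqP; rewrite eqn_leq jk andbT ltnNge; apply/negP => jk1.
have : (m %| 2 ^ k)%N by rewrite mE dvdn_exp2l.
rewrite (prim_order_dvd zm) z2 eq_sym -subr_eq0 opprK.
by rewrite -[_ + _]/(2%:R) pnatr_eq0.
Qed.

Lemma sum_prim_root (F : fieldType) (w : F) N k : N.-primitive_root w ->
  \sum_(j < N) w ^+ (j * k) = if (N %| k)%N then N%:R else 0.
Proof.
move=> wN; under eq_bigr do rewrite mulnC exprM.
case: ifP => Nk.
  have /eqP -> : w ^+ k == 1 by rewrite -(prim_order_dvd wN).
  by under eq_bigr do rewrite expr1n; rewrite sumr_const card_ord.
have wk : w ^+ k - 1 != 0 by rewrite subr_eq0 -(prim_order_dvd wN) Nk.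
apply: (mulfI wk); rewrite -subrX1 mulr0 exprAC (prim_expr_order wN) expr1n.
by rewrite subrr.
Qed.

Lemma ReM_real (x : R) (z : Cx R) : complex.Re (x%:C%C * z) = x * complex.Re z.
Proof. by case: z => a b /=; rewrite mul0r subr0. Qed.

Lemma cabs_prim_root (w : Cx R) N : N.-primitive_root w -> cabs w = 1.
Proof.
move=> wN; have N0 := prim_order_gt0 wN.
apply/eqP; rewrite -(@pexpr_eq1 _ _ N) ?cabs_ge0// -cabsX (prim_expr_order wN).
by rewrite cabs1.
Qed.

Lemma conj_prim_root (w : Cx R) N k : N.-primitive_root w -> (k <= N)%N ->
  ((w ^+ (N - k))^*)%C = w ^+ k.
Proof.
move=> wN kN.
have h : w ^+ (N - k) * w ^+ k = 1 by rewrite -exprD subnK// (prim_expr_order wN).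
have h2 : w ^+ (N - k) * ((w ^+ (N - k))^*)%C = 1.
  by rewrite -sqr_normc normCxE cabsX (cabs_prim_root wN) expr1n expr1n.
have n0 : w ^+ (N - k) != 0.
  by apply/eqP => w0; move: h; rewrite w0 mul0r => /esym/eqP; rewrite oner_eq0.
by apply: (mulfI n0); rewrite h h2.
Qed.

(** Discrete Fourier extraction: summing over the N-gon keeps only the degrees m congruent to - k
    modulo N. *)
Lemma sum_poly_prim_root (p : nat -> Cx R) (x w : Cx R) N M k : N.-primitive_root w ->
  \sum_(j < N) (\sum_(m < M) p m * (x * w ^+ j) ^+ m) * w ^+ (j * k)
  = N%:R * \sum_(m < M | (N %| m + k)%N) p m * x ^+ m.
Proof.
move=> wN; under eq_bigr do rewrite big_distrl/=.
rewrite exchange_big/= big_distrr/= [RHS]big_mkcond/=; apply: eq_bigr => m _.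
rewrite (eq_bigr (fun j : 'I_N => p m * x ^+ m * w ^+ (j * (m + k)))); last first.
  by move=> j _; rewrite exprMn -exprM mulrA -mulrA -exprD -mulnDr.
rewrite -big_distrr/= (sum_prim_root _ wN).
by case: ifP => _; rewrite ?mulr0// mulrC.
Qed.

(* The average of 2 (Re P + e) >= 0 against w^(-jn) over the vertices x w^j of a regular N-gon
   is p_n x^n: the conjugate of P does not contribute because N >= 2 M. *)
Lemma caratheodory_poly (p : nat -> Cx R) (x : R) (e : R) M n :
  0 <= x -> (0 < n < M)%N ->
  (forall z : Cx R, cabs z = x -> - e <= complex.Re (\sum_(m < M) p m * z ^+ m)) ->
  cabs (p n) * x ^+ n <= 2 * complex.Re (p 0%N) + 2 * e.
Proof.
move=> x0 /andP[n0 nM] hP.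
have [w] := exists_prim_root_pow2 (Cx R) M.
(* With N >= 2 M, the sum of two degrees below M never reaches N. *)
have : (M + M <= 2 ^ M.+1)%N by rewrite addnn -mul2n expnS leq_mul2l ltnW// ltn_expl.
move: (2 ^ M.+1)%N => N MN wN; have N0 := prim_order_gt0 wN.
have MN1 : (M <= N)%N := leq_trans (leq_addr M M) MN.
pose z j := x%:C%C * w ^+ j : Cx R.
pose P j := \sum_(m < M) p m * z j ^+ m.
have zx j : cabs (z j) = x.
  by rewrite cabsM cabsX (cabs_prim_root wN) expr1n mulr1 cabs_real ger0_norm.
have sum0 : \sum_(j < N) P j = N%:R * p 0%N.
  have := sum_poly_prim_root p x%:C%C M 0 wN.
  under eq_bigr do rewrite muln0 expr0 mulr1.
  move=> ->; congr (_ * _); rewrite (big_pred1 (Ordinal (ltn_trans n0 nM))) ?expr0 ?mulr1//.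
  move=> m /=; rewrite addn0; apply/idP/eqP => [Nm|->]; last by rewrite dvdn0.
  apply: val_inj => /=; apply/eqP; rewrite eqn0Ngt; apply/negP => m0.
  by have := dvdn_leq m0 Nm; rewrite leqNgt (leq_trans (ltn_ord m)).
have sumn : \sum_(j < N) P j * w ^+ (j * n) = 0.
  rewrite (sum_poly_prim_root p x%:C%C M n wN) big_pred0 ?mulr0// => m.
  apply/negP => Nm; have mn0 : (0 < m + n)%N by rewrite addn_gt0 n0 orbT.
  have := dvdn_leq mn0 Nm; rewrite leqNgt => /negP; apply.
  by apply: leq_trans MN; rewrite -addnS leq_add// ltnW.
(* The exponent N - n plays the role of - n; as 0 < m + N - n < 2 N, only m = n is kept. *)
have sumN : \sum_(j < N) P j * w ^+ (j * (N - n)) = N%:R * (p n * x%:C%C ^+ n).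
  rewrite (sum_poly_prim_root p x%:C%C M (N - n) wN); congr (_ * _).
  rewrite (big_pred1 (Ordinal nM))// => m /=.
  have nN : (n <= N)%N := leq_trans (ltnW nM) MN1.
  apply/idP/eqP => [|->]; last by rewrite /= subnKC.
  move=> Nm; apply: val_inj => /=.
  have [k kE] := dvdnP Nm.
  have mM := ltn_ord m.
  have k1 : k = 1%N by nia.
  by move: kE; rewrite k1 mul1n => ?; lia.
pose T j := complex.Re (P j) + e.
have T0 j : 0 <= T j by rewrite /T -lerBlDr sub0r; apply: hP.
have TE j : (2 * T j)%:C%C = P j + ((P j)^*)%C + (2 * e)%:C%C :> Cx R.
  by rewrite addcJ /T mulrDr rmorphD rmorphM /= rmorph_nat.
have main : \sum_(j < N) (2 * T j)%:C%C * w ^+ (j * (N - n)) = N%:R * (p n * x%:C%C ^+ n).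
  under eq_bigr do rewrite TE 2!mulrDl.
  rewrite 2!big_split /= sumN -[RHS]addr0 -addrA; congr (_ + _).
  have nN : (n <= N)%N := leq_trans (ltnW nM) MN1.
  (* Conjugation turns w^(j (N - n)) into w^(j n), which reduces this sum to [sumn]. *)
  have -> : \sum_(j < N) ((P j)^*)%C * w ^+ (j * (N - n)) = 0.
    transitivity ((\sum_(j < N) P j * w ^+ (j * n))^*)%C; last by rewrite sumn conjc0.
    rewrite rmorph_sum /=; apply: eq_bigr => j _.
    rewrite rmorphM /= [(j * n)%N]mulnC [w ^+ (n * j)]exprM -(conj_prim_root wN nN) rmorphXn /= conjcK.
    by rewrite mulnC exprM.
  rewrite add0r -big_distrr/= (sum_prim_root _ wN) ifF ?mulr0//.
  have nN1 : (n < N)%N := leq_trans nM MN1.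
  apply/negP => /dvdn_leq h.
  have : (N <= N - n)%N by apply: h; rewrite subn_gt0.
  by rewrite leqNgt ltn_subrL n0 N0.
have NR0 : 0 < N%:R :> R by rewrite ltr0n.
have : cabs (\sum_(0 <= j < N) (2 * T j)%:C%C * w ^+ (j * (N - n)))
    <= \sum_(0 <= j < N) 2 * T j.
  apply: le_trans (cabs_sum _ _ _) _; apply: ler_sum => j _.
  by rewrite cabsM cabsX (cabs_prim_root wN) expr1n mulr1 cabs_real ger0_norm ?mulr_ge0.
rewrite !big_mkord main -big_distrr /= big_split /= sumr_const card_ord.
have -> : \sum_(j < N) complex.Re (P j) = N%:R * complex.Re (p 0%N).
  transitivity (complex.Re (\sum_(j < N) P j)).
    by elim/big_ind2: _ => // x1 z1 x2 z2 -> ->; rewrite ReD.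
  by rewrite sum0 -(rmorph_nat (real_complex R)) ReM_real.
rewrite cabsM cabs_nat cabsM cabsX cabs_real (ger0_norm x0) -[e *+ N]mulr_natl -mulrDr.
by rewrite [leRHS]mulrCA ler_pM2l// mulrDr.
Qed.

(** The polynomial case applies to a truncation on the circle of radius x < 1, with the tail as
    error e; then e tends to 0 and x to 1. *)
Lemma caratheodory (g : Cx R -> Cx R) (u : nat -> Cx R) n : pseries_on u 0 1 g ->
  (forall z, unit_disc z -> 0 < complex.Re (g z)) -> (0 < n)%N ->
  cabs (u n) <= 2 * complex.Re (u 0%N).
Proof.
move=> ug g0 n0.
have key (x e : R) : 0 < x < 1 -> 0 < e ->
    cabs (u n) * x ^+ n <= 2 * complex.Re (u 0%N) + 2 * e.
  move=> /andP[x0 x1] e0.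
  have c := pseries_abs_cvg ug ltr01 (ltW x0) x1.
  have [M0 _ M0P] : \forall M \near \oo, limn (series (fun k => k%:R ^+ 2 * (cabs (u k) * x ^+ k)))
       - series (fun k => k%:R ^+ 2 * (cabs (u k) * x ^+ k)) M < e.
    have /cvgrPdist_lt/(_ e e0) := c; apply: filterS => M.
    exact: le_lt_trans (ler_norm _).
  set s := series _ in c M0P *.
  (* M > n keeps the degree n in the truncation, and M >= 1 makes the weight k^2 at least 1 on the
     tail. *)
  pose M := maxn M0 n.+1.
  have {}M0P := M0P M (leq_maxl _ _).
  apply: (@caratheodory_poly u x e M) => //; first exact: ltW.
    by rewrite n0 leq_maxr.
  move=> z zx.
  have z1 : unit_disc z by rewrite /unit_disc/= normCxE zx ltcR.
  have z1' : `|z - 0| < 1 by rewrite subr0.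
  have gz := ug _ z1'; rewrite subr0 in gz.
  have -> : \sum_(m < M) u m * z ^+ m = series (fun m => u m * z ^+ m) M.
    by rewrite seriesEord.
  have tail : cabs (g z - series (fun m => u m * z ^+ m) M) <= limn s - s M.
    have c1 : (fun N => cabs (series (fun m => u m * z ^+ m) N - series (fun m => u m * z ^+ m) M))
       @ \oo --> cabs (g z - series (fun m => u m * z ^+ m) M).
      by apply: cvg_cabs; apply: cvgB; [exact: gz|exact: cvg_cst].
    have c2 : (fun N => s N - s M) @ \oo --> limn s - s M.
      by apply: cvgB; [exact: c|exact: cvg_cst].
    apply: (ler_cvg_to c1 c2); near=> N.
    have MN : (M <= N)%N by near: N; exact: nbhs_infty_ge.
    rewrite /s !sub_series_geq//.
    apply: le_trans (cabs_sum _ _ _) _; apply: ler_sum_nat => i /andP[Mi _].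
    rewrite cabsM cabsX zx ler_peMl ?mulr_ge0 ?cabs_ge0 ?exprn_ge0 ?(ltW x0)//.
    by rewrite exprn_ege1// ler1n (leq_trans _ Mi)// leq_max orbT.
  have := le_trans (le_trans (ler_norm _) (Re_le_cabs _)) tail; rewrite ReB.
  by have := g0 _ z1; lra.
have key2 (x : R) : 0 < x < 1 -> cabs (u n) * x ^+ n <= 2 * complex.Re (u 0%N).
  move=> x01; apply/ler_addgt0Pr => e e0.
  have e20 : 0 < e / 2 by rewrite divr_gt0.
  by have := key x _ x01 e20; lra.
have c1 : (fun j => cabs (u n) * (1 - harmonic j) ^+ n) @ \oo --> cabs (u n) * (1 - 0) ^+ n.
  apply: cvgM; first exact: cvg_cst.
  by apply: cvg_exprn; apply: cvgB; [exact: cvg_cst|exact: cvg_harmonic].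
rewrite subr0 expr1n mulr1 in c1.
have c2 : (fun _ : nat => 2 * complex.Re (u 0%N)) @ \oo --> 2 * complex.Re (u 0%N).
  exact: cvg_cst.
apply: (ler_cvg_to c1 c2); near=> j; apply: key2.
have j0 : (0 < j)%N by near: j; exact: nbhs_infty_ge.
by rewrite /= subr_gt0 ltrBlDr ltrDl invr_gt0 ltr0n invf_lt1// ltr1n ltnS j0.
Unshelve. all: by end_near. Qed.

End Caratheodory.

(** * The sum over the kernel coefficients *)

Section Hypergeometric.
Variable R : realType.

Lemma real_pochhammer (x : R) n : pochhammer (x%:C%C : Cx R) n = (pochhammer x n)%:C%C.
Proof.
rewrite /pochhammer rmorph_prod /=; apply: eq_bigr => i _.
by rewrite rmorphD /= rmorph_nat.
Qed.

Lemma hyp2F1_coef_real (a b c : R) n :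
  hyp2F1_coef (a%:C%C : Cx R) b%:C%C c%:C%C n = (gauss_term a b c n)%:C%C.
Proof.
rewrite /hyp2F1_coef /gauss_term !real_pochhammer pochhammer1.
by rewrite fmorph_div !rmorphM /= rmorph_nat.
Qed.

(** F equals the Gauss series at the points - (1 - 1 / (j + 1)) of the disc, which tend to -1, and F
    is continuous there because -1 lies in the slit plane. *)
Lemma hyp2F1_at_N1 (a b c : R) (F : Cx R -> Cx R) :
  is_hyp2F1 a%:C%C b%:C%C c%:C%C F ->
  (fun j => limn (series (fun n => gauss_term a b c n * (- (1 - harmonic j)) ^+ n)))
  @ \oo --> complex.Re (F (-1)).
Proof.
move=> [Fan F0].
have slitN1 : @slit_plane R (-1).
  move=> [x /=]; rewrite in_itv/= andbT => x1 /(congr1 (@complex.Re R)) /=.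
  by move=> xN1; move: x1; rewrite xN1; lra.
have [r r0 [u uF]] := Fan _ slitN1.
have Fc := pseries_cvg_center uF r0.
pose z j := (- (1 - harmonic j : R))%:C%C : Cx R.
have zN1 : z @ \oo --> (-1 : Cx R).
  apply/cvg_CxP => e e0.
  have /cvgrPdist_lt/(_ e e0) := @cvg_harmonic R; apply: filterS => j.
  have -> : z j - (-1) = (harmonic j)%:C%C.
    by rewrite /z rmorphN rmorphB rmorph1; ring.
  by rewrite cabs_real sub0r normrN.
have Fz : (fun j => F (z j)) @ \oo --> F (-1) by apply: (cvg_comp z F zN1 Fc).
have := cvg_Re Fz.
apply: cvg_trans; apply: near_eq_cvg; near=> j.
have z1 : `|z j - 0| < 1.
  rewrite subr0 normCxE cabs_real normrN ltcR ger0_norm.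
    by rewrite ltrBlDr ltrDl harmonic_gt0.
  by rewrite subr_ge0 /= invf_le1// ler1n.
have := cvg_Re (F0 _ z1).
have -> : (fun N => complex.Re (series (fun n =>
      hyp2F1_coef (a%:C%C : Cx R) b%:C%C c%:C%C n * (z j - 0) ^+ n) N))
    = series (fun n => gauss_term a b c n * (- (1 - harmonic j)) ^+ n).
  apply/funext => N; rewrite Re_series; congr (series _ N); apply/funext => n.
  by rewrite subr0 hyp2F1_coef_real /z -rmorphXn -rmorphM.
by move=> h; rewrite (cvg_lim _ h).
Unshelve. all: by end_near. Qed.

(** The n-th coefficient of the 3F2 kernel for real a, b and c > 0, after the powers of 4 from the
    duplication formula cancel. *)
Definition clausen_term (a b c : R) n : R :=
  pochhammer a n * pochhammer b n.*2 / (pochhammer c n.*2 * n`!%:R).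

(** Replacing 2F1 at 1 by the larger Gamma quotient requires Re F(-1) >= 0; this follows from the
    case N = 1, where the sum is 1. *)
Lemma sum_clausen_term_le (a b c : R) (F : Cx R -> Cx R) N :
  0 < a -> 0 < b -> a + b < c -> b + 1 < c ->
  is_hyp2F1 a%:C%C b%:C%C (c - a)%:C%C F ->
  \sum_(n < N) clausen_term a b c n
  <= Gamma c * Gamma (c - a - b) / (Gamma (c - a) * Gamma (c - b)) * complex.Re (F (-1)).
Proof.
move=> a0 b0 abc bc hF; have c0 : 0 < c by lra.
have L := hyp2F1_at_N1 hF.
have h n := @even_gauss_sum_le R a b c _ n a0 b0 abc bc L.
apply: le_trans (h N) _.
have H0 : 0 <= gauss_sum a b c.
  apply: limr_ge; first exact: is_cvg_gauss.
  near=> n; rewrite /series /= sumr_ge0// => i _.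
  by rewrite ltW// gauss_term_gt0.
have h1 := h 1%N; rewrite big_ord1 !pochhammer0 fact0 !mulr1 divr1 in h1.
have L0 : 0 <= complex.Re (F (-1)).
  rewrite leNgt; apply/negP => L0.
  by have := mulr_ge0_le0 H0 (ltW L0); rewrite leNgt (lt_le_trans ltr01 h1).
exact: ler_wpM2r L0 _ _ (gauss_sum_le_Gamma a0 b0 abc).
Unshelve. all: by end_near. Qed.

Lemma clausen_termS (a b c : R) n : 0 < c ->
  n.+1%:R * clausen_term a b c n.+1
  = a * pochhammer b 2 / pochhammer c 2 * clausen_term (a + 1) (b + 2) (c + 2) n.
Proof.
move=> c0; rewrite /clausen_term pochhammerSl factS natrM.
have p2 (x : R) : pochhammer x n.+1.*2 = pochhammer x 2 * pochhammer (x + 2) n.*2.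
  by rewrite doubleS -addn2 addnC pochhammerD.
rewrite !p2.
have c2 : 0 < pochhammer (c + 2) n.*2 by rewrite pochhammer_gt0// addr_gt0.
have c3 : 0 < pochhammer c 2 by rewrite pochhammer_gt0.
have n1 : 0 < n.+1%:R :> R by rewrite ltr0n.
have nf := fact_neq0 R n.
move: (pochhammer (c + 2) _) (pochhammer c 2) (n.+1%:R) c2 c3 n1 => x y w x0 y0 w0.
by field; rewrite nf !gt_eqF.
Qed.

(** Split 2 n + 1 as 1 + 2 n and shift the second part by [clausen_termS]; c > a + b + 1 is exactly
    the condition a + b < c for the parameters (a + 1, b + 2, c + 2). *)
Lemma sum_weighted_clausen_le (a b c : R) (F1 F2 : Cx R -> Cx R) N :
  0 < a -> 0 < b -> a + b + 1 < c ->
  is_hyp2F1 (a + 1)%:C%C (b + 2)%:C%C (c - a + 1)%:C%C F1 ->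
  is_hyp2F1 a%:C%C b%:C%C (c - a)%:C%C F2 ->
  \sum_(n < N.+1) (n.*2.+1)%:R * clausen_term a b c n
  <= Gamma c * Gamma (c - a - b) / (Gamma (c - a) * Gamma (c - b))
     * (2 * a * pochhammer b 2 / ((c - a) * (c - a - b - 1)) * complex.Re (F1 (-1))
        + complex.Re (F2 (-1))).
Proof.
move=> a0 b0 abc hF1 hF2; have c0 : 0 < c by lra.
have ca0 : 0 < c - a by lra.
have cab0 : 0 < c - a - b - 1 by lra.
have a1 : 0 < a + 1 by lra.
have b2 : 0 < b + 2 by lra.
have abc0 : a + b < c by lra.
have bc0 : b + 1 < c by lra.
have abc2 : a + 1 + (b + 2) < c + 2 by lra.
have bc2 : b + 2 + 1 < c + 2 by lra.
have g1 : 0 < Gamma (c - a) by exact: Gamma_gt0.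
have g2 : 0 < Gamma (c - b) by apply: Gamma_gt0; lra.
have h2 : \sum_(n < N.+1) clausen_term a b c n
    <= Gamma c * Gamma (c - a - b) / (Gamma (c - a) * Gamma (c - b)) * complex.Re (F2 (-1)).
  exact: sum_clausen_term_le hF2.
have h1 : \sum_(n < N) clausen_term (a + 1) (b + 2) (c + 2) n
    <= Gamma (c + 2) * Gamma (c - a - b - 1) / (Gamma (c - a + 1) * Gamma (c - b))
       * complex.Re (F1 (-1)).
  have e1 : c - a + 1 = c + 2 - (a + 1) by ring.
  have e2 : c - a - b - 1 = c + 2 - (a + 1) - (b + 2) by ring.
  have e3 : c - b = c + 2 - (b + 2) by ring.
  rewrite e1 in hF1; rewrite e2 e3 e1.
  exact: sum_clausen_term_le a1 b2 abc2 bc2 hF1.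
have -> : \sum_(n < N.+1) (n.*2.+1)%:R * clausen_term a b c n
  = \sum_(n < N.+1) clausen_term a b c n
    + 2 * (a * pochhammer b 2 / pochhammer c 2
           * \sum_(n < N) clausen_term (a + 1) (b + 2) (c + 2) n).
  transitivity (\sum_(n < N.+1) clausen_term a b c n
      + 2 * \sum_(n < N.+1) n%:R * clausen_term a b c n).
    rewrite [2 * _]big_distrr -big_split /=; apply: eq_bigr => n _.
    by rewrite -natr1 -muln2 natrM; ring.
  congr (_ + 2 * _); rewrite big_ord_recl mul0r add0r big_distrr /=.
  by apply: eq_bigr => n _; rewrite /bump /= add1n clausen_termS.
have p0 : 0 < a * pochhammer b 2 / pochhammer c 2.
  by rewrite divr_gt0 ?mulr_gt0 ?pochhammer_gt0.
rewrite mulrDr addrC; apply: lerD; last exact: h2.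
have two0 : 0 < 2 :> R by [].
rewrite mulrA; have := ler_wpM2l (ltW (mulr_gt0 two0 p0)) h1; move=> /le_trans; apply.
(* The recurrence of Gamma at c, c - a and c - a - b - 1 turns the shifted quotient into the one of
   the statement. *)
have -> : Gamma (c + 2) = (c + 1) * c * Gamma c.
  have -> : c + 2 = c + 1 + 1 by ring.
  by rewrite !GammaD1 ?mulrA// addr_gt0.
have := GammaD1 cab0; rewrite subrK => ->; rewrite (GammaD1 ca0).
have -> : pochhammer c 2 = c * (c + 1).
  by rewrite !pochhammerS pochhammer0 mul1r addr0.
move: (Gamma (c - a)) (Gamma (c - b)) (Gamma c) (Gamma (c - a - b - 1)) g1 g2.
move=> x y v w x0 y0; rewrite le_eqVlt; apply/orP; left; apply/eqP.
have n1 : c + 1 != 0 by rewrite gt_eqF// addr_gt0.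
by field; rewrite n1 !gt_eqF.
Qed.

End Hypergeometric.

(** * Uniform convexity *)

Section UniformConvexity.
Variable R : realType.

(** Caratheodory's inequality for e^(i phi) (f' - beta): the constant term has real part (1 - beta)
    cos phi <= 1 - beta, and f' has coefficient (n + 2) u_(n+2) in degree n + 1. *)
Lemma classR_coef_le (beta : R) (f : Cx R -> Cx R) (u : nat -> Cx R) n :
  beta < 1 -> u 1%N = 1 -> pseries_on u 0 1 f ->
  (exists phi : R, forall z, unit_disc z ->
    0 < complex.Re ((cos phi +i* sin phi)%C * (f^`()%classic z - beta%:C%C))) ->
  n.+2%:R * cabs (u n.+2) <= 2 * (1 - beta).
Proof.
move=> beta1 u1 uf [phi hphi].
pose e : Cx R := (cos phi +i* sin phi)%C.
have e1 : cabs e = 1 by rewrite cabsE /= cos2Dsin2 sqrtr1.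
pose B : Cx R := beta%:C%C; pose w k := if k == 0%N then B else 0.
pose v k := e * (pderiv u k - w k).
have vg : pseries_on v 0 1 (fun z => e * (f^`()%classic z - beta%:C%C)).
  move=> z z1; have h := pseries_derive1 uf ltr01 z1.
  have hb : series (fun k => w k * (z - 0) ^+ k) @ \oo
      --> B.
    apply: cvg_near_cst; near=> N.
    have N0 : (0 < N)%N by near: N; exact: nbhs_infty_ge.
    rewrite /series /= -(prednK N0) big_nat_recl//= expr0 mulr1 big1 ?addr0// => i _.
    by rewrite mul0r.
  have -> : series (fun k => v k * (z - 0) ^+ k) = (fun N => e *
     (series (fun k => pderiv u k * (z - 0) ^+ k) N
      - series (fun k => w k * (z - 0) ^+ k) N)).
    apply/funext => N; rewrite /series /= -sumrB big_distrr /=.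
    by apply: eq_bigr => i _; rewrite /v; ring.
  by apply: cvgM; [exact: cvg_cst|apply: cvgB; [exact: h|exact: hb]].
have := caratheodory vg hphi (ltn0Sn n).
rewrite /v /w /= subr0 cabsM e1 mul1r /pderiv cabsM cabs_nat => /le_trans; apply.
rewrite ler_pM2l// mul1r u1 /B; have -> : 1 - beta%:C%C = (1 - beta)%:C%C :> Cx R.
  by rewrite rmorphB rmorph1.
rewrite mulrC ReM_real /= ler_piMr ?cos_le1//; lra.
Unshelve. all: by end_near. Qed.

Lemma Re_quotient_gt0 (x p q : Cx R) : cabs x < 2 -> 0 < cabs p ->
  2 * cabs q <= cabs p -> 0 < complex.Re (1 + x * q / p).
Proof.
move=> x2 p0 qp.
suff : cabs (x * q / p) < 1.
  move=> h; have := le_lt_trans (Re_le_cabs _) h.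
  by rewrite ltr_norml => /andP[h' _]; rewrite ReD /= -ltrBlDl sub0r.
rewrite !cabsM cabsV ltr_pdivrMr// mul1r.
(* The strict bound on |x| survives multiplication by |q| only when q is nonzero. *)
have := cabs_ge0 q; rewrite le_eqVlt => /orP[/eqP <-|q0]; first by rewrite mulr0.
by apply: lt_le_trans qp; rewrite ltr_pM2r.
Qed.

(* As (k + 2)(2k + 3) = (k + 2) + 2 (k + 1)(k + 2), the hypothesis bounds
   |h' - 1| + 2 |h''| by 1 on the disc, and |z - zeta| < 2. *)
Lemma UCV_coef_bound (h : Cx R -> Cx R) (d : nat -> Cx R) :
  d 0%N = 0 -> d 1%N = 1 -> pseries_on d 0 1 h ->
  (forall N, \sum_(k < N) (k.+2 * k.*2.+3)%:R * cabs (d k.+2) <= 1) -> UCV h.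
Proof.
move=> d0 d1 hd hN.
have hd1 := pseries_derive1 hd ltr01.
have hd2 : pseries_on (pderiv (pderiv d)) 0 1 h^`(2)%classic.
  by rewrite derive1nS derive1n1; exact: pseries_derive1 hd1 ltr01.
pose A N := \sum_(k < N) k.+2%:R * cabs (d k.+2).
pose B N := \sum_(k < N) (k.+1 * k.+2)%:R * cabs (d k.+2).
have AB N : A N + 2 * B N <= 1.
  apply: le_trans (hN N); rewrite /A /B big_distrr -big_split /=.
  apply: ler_sum => k _; rewrite !natrM -muln2 -!natr1 natrM.
  by rewrite le_eqVlt; apply/orP; left; apply/eqP; ring.
(* As 2 k + 3 >= 3, the first-derivative sum is at most 1/3, which keeps h' away from 0. *)
have A3 N : 3 * A N <= 1.
  apply: le_trans (hN N); rewrite /A big_distrr /=.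
  apply: ler_sum => k _; rewrite mulrA ler_wpM2r ?cabs_ge0// -natrM ler_nat mulnC.
  by rewrite leq_mul2l.
have P1 N (z : Cx R) : cabs z < 1 ->
    cabs (series (fun n => pderiv d n * z ^+ n) N.+1 - 1) <= A N.
  move=> z1; rewrite /series /= big_nat_recl//= /pderiv d1 expr0 !mulr1 addrC addKr.
  apply: le_trans (cabs_sum _ _ _) _; rewrite big_mkord; apply: ler_sum => k _.
  rewrite !cabsM cabs_nat cabsX ler_piMr ?mulr_ge0 ?cabs_ge0//.
  by rewrite exprn_ile1 ?cabs_ge0 ?(ltW z1).
have P2 N (z : Cx R) : cabs z < 1 ->
    cabs (series (fun n => pderiv (pderiv d) n * z ^+ n) N) <= B N.
  move=> z1; apply: le_trans (cabs_sum _ _ _) _; rewrite big_mkord; apply: ler_sum => k _.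
  rewrite /pderiv !cabsM !cabs_nat cabsX mulrA -natrM ler_piMr ?mulr_ge0 ?cabs_ge0//.
  by rewrite exprn_ile1 ?cabs_ge0 ?(ltW z1).
have lims (z : Cx R) : cabs z < 1 ->
    cabs (h^`()%classic z - 1) + 2 * cabs (h^`(2)%classic z) <= 1
    /\ cabs (h^`()%classic z - 1) <= 3^-1.
  move=> z1; have z1' : `|z - 0| < 1 by rewrite subr0 normCxE ltcR.
  have c0 : (fun N => series (fun n => pderiv d n * z ^+ n) N.+1) @ \oo --> h^`()%classic z.
    by have := hd1 _ z1'; rewrite subr0 -(cvg_shiftn 1); under eq_fun do rewrite addn1.
  have c0' : (fun N => series (fun n => pderiv d n * z ^+ n) N.+1 - 1) @ \oo
      --> h^`()%classic z - 1 by exact: (cvgB c0 (cvg_cst (1 : Cx R))).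
  have c1 := cvg_cabs c0'.
  have c2 : (fun N => cabs (series (fun n => pderiv (pderiv d) n * z ^+ n) N)) @ \oo
      --> cabs (h^`(2)%classic z).
    by apply: cvg_cabs; have := hd2 _ z1'; rewrite subr0.
  split.
    have c3 : (fun N => cabs (series (fun n => pderiv d n * z ^+ n) N.+1 - 1)
       + 2 * cabs (series (fun n => pderiv (pderiv d) n * z ^+ n) N)) @ \oo
       --> cabs (h^`()%classic z - 1) + 2 * cabs (h^`(2)%classic z).
      by apply: cvgD; [exact: c1|apply: cvgM; [exact: cvg_cst|exact: c2]].
    apply: (ler_cvg_to c3 (cvg_cst (1 : R))); near=> N.
    apply: le_trans (AB N); apply: lerD; first exact: P1.
    by rewrite ler_pM2l// P2.
  apply: (ler_cvg_to c1 (cvg_cst (3^-1 : R))); near=> N.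
  by apply: le_trans (P1 N z z1) _; rewrite -[leRHS]mulr1 ler_pdivlMl.
have h1_ge (z : Cx R) : 1 - cabs (h^`()%classic z - 1) <= cabs (h^`()%classic z).
  rewrite lerBlDr -cabs1 -[X in cabs X <= _](subKr (h^`()%classic z)).
  exact: cabsB.
have h1_gt0 (z : Cx R) : cabs z < 1 -> 0 < cabs (h^`()%classic z).
  move=> z1; apply: lt_le_trans (h1_ge z); rewrite subr_gt0.
  by have [_ /le_lt_trans] := lims z z1; apply; rewrite invf_lt1// ltr1n.
have discP (z : Cx R) : unit_disc z -> cabs z < 1 by rewrite /unit_disc /= normCxE ltcR.
split; first by exists d.
- by move=> z /discP z1; rewrite -cabs_gt0 h1_gt0.
move=> z zeta /discP z1 /discP zeta1.
have [h12 _] := lims z z1.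
apply: Re_quotient_gt0.
- have -> : 2 = 1 + 1 :> R by rewrite -natr1.
  by apply: le_lt_trans (cabsB _ _) _; rewrite ltrD.
- exact: h1_gt0.
- by apply: le_trans (h1_ge z); rewrite lerBrDl.
Unshelve. all: by end_near. Qed.

End UniformConvexity.

(** * The kernel of the operator and its action on coefficients *)

Lemma pochhammer_double (K : numFieldType) (x : K) n :
  pochhammer x n.*2 = 4 ^+ n * (pochhammer (x / 2) n * pochhammer ((x + 1) / 2) n).
Proof.
elim: n => [|n ih]; first by rewrite !pochhammer0 !mul1r.
rewrite doubleS !pochhammerS ih exprS -!natr1 -muln2 natrM.
by field.
Qed.

Section ClausenOperator.
Variable R : realType.
Implicit Types a b : Cx R.

Lemma cabs_pochhammer_le a n : cabs (pochhammer a n) <= pochhammer (cabs a) n.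
Proof.
elim: n => [|n ih]; first by rewrite !pochhammer0 cabs1.
rewrite !pochhammerS cabsM; apply: ler_pM; rewrite ?cabs_ge0//.
by rewrite -(cabs_nat R n) cabsD.
Qed.

(** The powers of 4 from [pochhammer_double] cancel, c > 0 makes the denominator positive, and only
    the numerator is estimated. *)
Lemma cabs_clausen_coef_le a b (c : R) n : 0 < c ->
  cabs (hyp3F2_coef a (b / 2) ((b + 1) / 2) (c%:C%C / 2) ((c%:C%C + 1) / 2) n)
  <= clausen_term (cabs a) (cabs b) c n.
Proof.
move=> c0; have c4 : (4 ^+ n : Cx R) != 0 by rewrite expf_neq0.
have -> : hyp3F2_coef a (b / 2) ((b + 1) / 2) (c%:C%C / 2) ((c%:C%C + 1) / 2) n
  = pochhammer a n * pochhammer b n.*2 / (pochhammer c%:C%C n.*2 * n`!%:R).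
  rewrite /hyp3F2_coef !pochhammer_double pochhammer1.
  have cancel4 (x y z t : Cx R) : x * (4 ^+ n * y) / (4 ^+ n * z * t) = x * y / (z * t).
    by rewrite [x * _]mulrCA -[4 ^+ n * z * t]mulrA -mulf_div divff ?mul1r.
  by rewrite cancel4 mulrA.
rewrite real_pochhammer cabsM cabsV !cabsM cabs_nat cabs_real gtr0_norm ?pochhammer_gt0//.
rewrite /clausen_term ler_pM2r; last first.
  by rewrite invr_gt0 mulr_gt0 ?pochhammer_gt0// ltr0n fact_gt0.
by apply: ler_pM; rewrite ?cabs_ge0// cabs_pochhammer_le.
Qed.

(** Degree m + 2 takes the kernel coefficient of index m + 1 because the 3F2 is multiplied by z. *)
Definition clausen_op_coef a b (c : R) (u : nat -> Cx R) (n : nat) : Cx R :=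
  match n with
  | 0 => 0
  | 1 => 1
  | m.+2 => hyp3F2_coef a (b / 2) ((b + 1) / 2) (c%:C%C / 2) ((c%:C%C + 1) / 2) m.+1 * u m.+2
  end.

(** Summable coefficients make the series converge absolutely on the disc, so the limit in
    [clausen_op] is a genuine one; degrees 0 and 1 account for the shift by 2. *)
Lemma pseries_clausen_op a b (c : R) (f : Cx R -> Cx R) (u : nat -> Cx R) :
  pseries_on u 0 1 f ->
  cvgn (series (fun n => cabs (clausen_op_coef a b c u n.+2))) ->
  pseries_on (clausen_op_coef a b c u) 0 1 (clausen_op a b c%:C%C f).
Proof.
move=> uf cd z; rewrite subr0 => z1.
have z1' : cabs z < 1 by move: z1; rewrite normCxE ltcR.
set d := clausen_op_coef a b c u.
have dE : (fun n => hyp3F2_coef a (b / 2) ((b + 1) / 2) (c%:C%C / 2) ((c%:C%C + 1) / 2) n.+1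
    * taylor_coef f n.+2 * z ^+ n.+2) = (fun n => d n.+2 * z ^+ n.+2).
  by apply/funext => n; rewrite (taylor_coef_pseries _ uf ltr01).
have cz : cvgn (series (fun n => d n.+2 * z ^+ n.+2)).
  apply: cabs_is_cvg_series; apply: (dominated_series _ cd) => n.
  rewrite ger0_norm ?cabs_ge0// cabsM cabsX ler_piMr ?cabs_ge0//.
  by rewrite exprn_ile1 ?cabs_ge0 ?(ltW z1').
rewrite /clausen_op dE -(cvg_shiftn 2).
have -> : (fun N => series (fun n => d n * z ^+ n) (N + 2)%N)
    = (fun N => z + series (fun n => d n.+2 * z ^+ n.+2) N).
  apply/funext => N; rewrite addn2 /series /= big_nat_recl//= big_nat_recl//=.
  by rewrite mul0r add0r mul1r expr1.
by apply: cvgD; [exact: cvg_cst|exact: cz].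
Qed.

End ClausenOperator.

Theorem theorem4p3 (R : realType) (a b : Cx R) (c beta : R)
  (F1 F2 : Cx R -> Cx R)
  (ha : a != 0) (hb : b != 0) (hc : 0 < c) (hcab : cabs a + cabs b + 1 < c)
  (hbeta0 : 0 <= beta) (hbeta1 : beta < 1)
  (hF1 : is_hyp2F1 (cabs a + 1)%:C%C (cabs b + 2)%:C%C (c - cabs a + 1)%:C%C F1)
  (hF2 : is_hyp2F1 (cabs a)%:C%C (cabs b)%:C%C (c - cabs a)%:C%C F2)
  (hmain :
    Gamma c * Gamma (c - cabs a - cabs b) / (Gamma (c - cabs a) * Gamma (c - cabs b))
    * (2 * cabs a * pochhammer (cabs b) 2
         / ((c - cabs a) * (c - cabs a - cabs b - 1)) * complex.Re (F1 (-1))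
       + complex.Re (F2 (-1)))
    <= 1 / (2 * (1 - beta)) + 1) :
  forall f : Cx R -> Cx R, classR beta f -> UCV (clausen_op a b c%:C%C f).
Proof.
move=> f [[u [u0 u1 uf]] hR].
have a0 : 0 < cabs a by rewrite cabs_gt0.
have b0 : 0 < cabs b by rewrite cabs_gt0.
have sum_le N := le_trans (sum_weighted_clausen_le N a0 b0 hcab hF1 hF2) hmain.
clear hmain hF1 hF2.
have beta0 : 0 < 2 * (1 - beta) by rewrite mulr_gt0// subr_gt0.
pose d := clausen_op_coef a b c u.
(* The factor n + 2 of the weight goes with |u_(n+2)|; the factor 2 n + 3 = 2 (n + 1) + 1 goes with
   the kernel coefficient of index n + 1. *)
have d_le n : (n.+2 * n.*2.+3)%:R * cabs (d n.+2)
    <= 2 * (1 - beta) * (n.+1.*2.+1%:R * clausen_term (cabs a) (cabs b) c n.+1).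
  have h1 := classR_coef_le n hbeta1 u1 uf hR.
  have h2 := cabs_clausen_coef_le a b n.+1 hc.
  rewrite /d /= cabsM natrM.
  rewrite [leLHS](_ : _ = (n.+2%:R * cabs (u n.+2)) * (n.*2.+3%:R *
    cabs (hyp3F2_coef a (b / 2) ((b + 1) / 2) (c%:C%C / 2) ((c%:C%C + 1) / 2) n.+1))); last by ring.
  by apply: ler_pM; rewrite ?mulr_ge0 ?cabs_ge0// ler_pM2l.
have dN N : \sum_(k < N) (k.+2 * k.*2.+3)%:R * cabs (d k.+2) <= 1.
  apply: (@le_trans _ _ (2 * (1 - beta) *
      \sum_(k < N) (k.+1.*2.+1%:R * clausen_term (cabs a) (cabs b) c k.+1))).
    by rewrite big_distrr /=; apply: ler_sum => k _; exact: d_le.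
  (* Adding the missing term of index 0, which is 1, completes the sum and accounts for the + 1 in
     the assumption. *)
  rewrite -ler_pdivlMl// mulr1 -div1r -(lerD2r 1) addrC; apply: le_trans (sum_le N).
  rewrite big_ord_recl /= lerD//.
  by rewrite /clausen_term double0 !pochhammer0 fact0 !mul1r invr1.
(* The weights in [dN] are at least 1, so these partial sums are bounded by 1. *)
have cd : cvgn (series (fun n => cabs (d n.+2))).
  apply: nondecreasing_is_cvgn.
    by apply: nondecreasing_series => n _ _; exact: cabs_ge0.
  exists 1 => _ [N _ <-]; apply: le_trans (dN N); rewrite seriesEord /=.
  apply: ler_sum => k _; rewrite ler_peMl ?cabs_ge0// ler1n muln_gt0//.
exact: (UCV_coef_bound (d := d)) (pseries_clausen_op uf cd) dN.
Qed.
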